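(* Let $d$ be any one of the nine asymmetric metrics $d_{\mathrm{g}},d_{\mathrm{cF}},d_{\mathrm{pF}},d_{\mathrm{FS}},d_{\mathrm{c\wedge}},d_{\mathrm{BC}},d_{\mathrm{A}},d_{\mathrm{c2}},d_{\mathrm{p2}}$ in $\mathrm{Gr}(n)$, let $\gamma:I\to \mathrm{Gr}^\pm(n)$ be a rectifiable curve (for either of the topologies $\tau^-$, $\tau^+$), and let $t_0\in I$. Then $$\Delta L(\gamma)\big|_{t_0}=\begin{cases}\Delta_{p,d} & \text{if } \gamma \text{ contracts from a $p$-dimensional subspace at } t_0,\\ 0 & \text{otherwise.}\end{cases}$$
   Context: $\mathbb{F}=\mathbb{R}$ or $\mathbb{C}$, $\mathbb{F}^n$ has its canonical inner product (Hermitian if $\mathbb{F}=\mathbb{C}$), $\mathrm{Gr}(n)$ is the set of all subspaces of $\mathbb{F}^n$, $\mathrm{Gr}_p(n)$ those of dimension $p$; $V_{(p)}$ indicates $\dim V=p$. Principal angles of $V_{(p)},W_{(q)}$ with $m=\min\{p,q\}\neq0$: $0\leq\theta_1\leq\cdots\leq\theta_m\leq\frac\pi2$, $\theta_i=\cos^{-1}\sigma_i$, where $\sigma_1\geq\cdots\geq\sigma_m$ are the singular values of the orthogonal projection $V\to W$. Asymmetric metrics: for $V_{(p)},W_{(q)}$, $d(V,W)=0$ if $p=0$, and $d(V,W)=\Delta_{p,d}$ if $p>q$. If $0<p\leq q$: $d_{\mathrm{g}}=\sqrt{\sum_{i=1}^p\theta_i^2}$, $d_{\mathrm{cF}}=2\sqrt{\sum_{i=1}^p\sin^2\frac{\theta_i}{2}}$,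 $d_{\mathrm{pF}}=\sqrt{\sum_{i=1}^p\sin^2\theta_i}$, $d_{\mathrm{FS}}=\cos^{-1}(\prod_{i=1}^p\cos\theta_i)$, $d_{\mathrm{c\wedge}}=\sqrt{2-2\prod_{i=1}^p\cos\theta_i}$, $d_{\mathrm{BC}}=\sqrt{1-\prod_{i=1}^p\cos^2\theta_i}$, $d_{\mathrm{A}}=\theta_p$, $d_{\mathrm{c2}}=2\sin\frac{\theta_p}{2}$, $d_{\mathrm{p2}}=\sin\theta_p$. For $p>0$ the constants $\Delta_{p,d}$ are, respectively, $\frac\pi2\sqrt p$, $\sqrt{2p}$, $\sqrt p$, $\frac\pi2$, $\sqrt2$, $1$, $\frac\pi2$, $\sqrt2$, $1$. Topologies: $\tau^-$ is generated by the balls $B_r^-(V)=\{U:d(U,V)<r\}$ and $\tau^+$ by $B_r^+(V)=\{U:d(V,U)<r\}$. $\mathrm{Gr}^\pm(n)$ is $\mathrm{Gr}(n)$ with $\tau^\pm$. A curve is a continuous map $\gamma:I\to \mathrm{Gr}^\pm(n)$ on an interval $I\subset\mathbb{R}$. Its length is $L(\gamma)=\sup\sum_{i=1}^{N-1}d(\gamma(t_i),\gamma(t_{i+1}))$ over all $N\in\mathbb{N}$ and $t_1<\cdots<t_N$ in $I$; it is rectifiable if $L(\gamma)<\infty$. The length change at $t_0\in I$ is $\Delta L(\gamma)|_{t_0}=\lim_{\delta\to0}L(\gamma|_{I\cap[t_0-\delta,t_0+\delta]})$. For a rectifiable curve and $t$ close to $t_0$ on one side of it, $\gamma(t)$ lies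 in a single $\mathrm{Gr}_k(n)$ and converges in its usual topology; this gives the one-sided limits $U=\lim_{t\to t_0^-}\gamma(t)$ and $W=\lim_{t\to t_0^+}\gamma(t)$. With $V=\gamma(t_0)$, $\gamma$ contracts at $t_0$ from $U$ to $V$ if $U\supsetneq V$, and from $V$ to $W$ if $V\supsetneq W$ (disregard $U$ if $t_0=\inf I$, and $W$ if $t_0=\sup I$). *)

(* Defs.v *)
From HB Require Import structures.
From mathcomp Require Import all_boot all_order all_algebra.
From mathcomp Require Import complex.
From mathcomp Require Import all_classical all_reals all_analysis.

Set Implicit Arguments.
Unset Strict Implicit.
Unset Printing Implicit Defensive.

Import Order.TTheory GRing.Theory Num.Theory.
Import numFieldNormedType.Exports.
Local Open Scope classical_set_scope.
Local Open Scope ring_scope.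

Variant scalar_kind := real_scalars | complex_scalars.

Definition scalars (R : realType) (k : scalar_kind) : numFieldType :=
  match k with real_scalars => R | complex_scalars => R[i] end.

Definition conjF {R : realType} {k : scalar_kind} :
    {rmorphism scalars R k -> scalars R k} :=
  match k return {rmorphism scalars R k -> scalars R k} with
  | real_scalars => idfun
  | complex_scalars => @conjc R
  end.

Definition of_real {R : realType} (k : scalar_kind) :
    {rmorphism R -> scalars R k} :=
  match k return {rmorphism R -> scalars R k} with
  | real_scalars => idfun
  | complex_scalars => real_complex R
  end.

Notation vec R k n := 'rV[scalars R k]_n.
Notation Gr R k n := {vspace 'rV[scalars R k]_n}.

Definition inner {R : realType} {k : scalar_kind} {n : nat} (u v : vec R k n) :
    scalars R k :=
  \sum_(j < n) u 0 j * conjF (v 0 j).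

Section InnerIsDot.
Variables (R : realType) (k : scalar_kind) (n : nat).

Lemma conjFK : involutive (@conjF R k).
Proof. by case: k => //= x; exact: conjcK. Qed.

Lemma mul_conjF_ge0 (x : scalars R k) : 0 <= x * conjF x.
Proof. by case: k x => /= x; [rewrite -expr2 sqr_ge0|exact: mul_conjC_ge0]. Qed.

Lemma inner_bilinear :
  bilinear_for
    ( *%R : GRing.Scale.law (scalars R k) (scalars R k))
    (GRing.Scale.Law.clone _ _ (@conjF R k \; *%R) _) (@inner R k n).
Proof.
split=> [v|u] a x y /=; rewrite /inner mulr_sumr -big_split/=;
  apply: eq_bigr => j _; rewrite !mxE.
  by rewrite mulrDl mulrA.
by rewrite rmorphD rmorphM mulrDr mulrCA.
Qed.

HB.instance Definition _ := bilinear_isBilinear.Build _ _ _ _ _ _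
  (@inner R k n) inner_bilinear.

Lemma inner_hermitian (u v : vec R k n) :
  inner u v = (-1) ^+ false * conjF (inner v u).
Proof.
rewrite expr0 mul1r /inner rmorph_sum; apply: eq_bigr => j _ /=.
by rewrite rmorphM conjFK mulrC.
Qed.

HB.instance Definition _ := isHermitianSesquilinear.Build _ _ false
  (@conjF R k) (@inner R k n) inner_hermitian.

Lemma inner_gt0 (u : vec R k n) : u != 0 -> 0 < inner u u.
Proof.
move=> u0; rewrite lt0r sumr_ge0 ?andbT => [|j _]; last exact: mul_conjF_ge0.
apply: contra u0; rewrite psumr_eq0 => [/allP h|j _]; last exact: mul_conjF_ge0.
apply/eqP/rowP => j; have := h j (mem_index_enum _).
by rewrite /= mulf_eq0 fmorph_eq0 orbb mxE => /eqP.
Qed.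

HB.instance Definition _ := isDotProduct.Build _ _ (@inner R k n) inner_gt0.

End InnerIsDot.

Definition orthoproj {R : realType} {k : scalar_kind} {n : nat}
    (W : Gr R k n) : 'End(vec R k n) :=
  daddv_pi W (orthov (@inner R k n) W).

(* [s] is the list of the min(dim V, dim W) singular values of the linear map
   [T : V -> W], in decreasing order, as given by a singular value
   decomposition T e_i = s_i f_i, T e_i = 0 for i >= size s. The second clause
   is covered by the first, since [nth] defaults to 0 past the end of [s]. *)
Definition is_singular_values {R : realType} {k : scalar_kind} {n : nat}
    (V W : Gr R k n) (T : 'End(vec R k n)) (s : seq R) : Prop :=
  [/\ size s = minn (\dim V) (\dim W), sorted >=%R s, all (>= 0) s &
      exists e f : seq (vec R k n),
        [/\ basis_of V e && orthonormal (@inner R k n) e,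
            basis_of W f && orthonormal (@inner R k n) f &
            forall i, (i < \dim V)%N -> T e`_i = of_real k s`_i *: f`_i]].

Definition singular_values {R : realType} {k : scalar_kind} {n : nat}
    (V W : Gr R k n) (T : 'End(vec R k n)) : seq R :=
  xget [::] [set s | is_singular_values V W T s].

Definition principal_angles {R : realType} {k : scalar_kind} {n : nat}
    (V W : Gr R k n) : seq R :=
  [seq acos x | x <- singular_values V W (orthoproj W)].

Variant asym_metric :=
  | geodesic | chordal_Frobenius | projection_Frobenius
  | Fubini_Study | chordal_wedge | Binet_Cauchy
  | Asimov | chordal_2norm | projection_2norm.

(* Only meant for p > 0. *)
Definition Delta {R : realType} (d : asym_metric) (p : nat) : R :=
  match d with
  | geodesic => pi / 2 * Num.sqrt p%:R
  | chordal_Frobenius => Num.sqrt (2 * p%:R)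
  | projection_Frobenius => Num.sqrt p%:R
  | Fubini_Study => pi / 2
  | chordal_wedge => Num.sqrt 2
  | Binet_Cauchy => 1
  | Asimov => pi / 2
  | chordal_2norm => Num.sqrt 2
  | projection_2norm => 1
  end.

(* [last 0 th] is the largest angle theta_p of a nonempty list [th]. *)
Definition angle_dist {R : realType} (d : asym_metric) (th : seq R) : R :=
  match d with
  | geodesic => Num.sqrt (\sum_(x <- th) x ^+ 2)
  | chordal_Frobenius => 2 * Num.sqrt (\sum_(x <- th) sin (x / 2) ^+ 2)
  | projection_Frobenius => Num.sqrt (\sum_(x <- th) sin x ^+ 2)
  | Fubini_Study => acos (\prod_(x <- th) cos x)
  | chordal_wedge => Num.sqrt (2 - 2 * \prod_(x <- th) cos x)
  | Binet_Cauchy => Num.sqrt (1 - \prod_(x <- th) cos x ^+ 2)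
  | Asimov => last 0 th
  | chordal_2norm => 2 * sin (last 0 th / 2)
  | projection_2norm => sin (last 0 th)
  end.

Definition asym_dist {R : realType} {k : scalar_kind} {n : nat}
    (d : asym_metric) (V W : Gr R k n) : R :=
  if \dim V == 0%N then 0
  else if (\dim W < \dim V)%N then Delta d (\dim V)
  else angle_dist d (principal_angles V W).

Variant topology_side := tau_minus | tau_plus.

Definition asym_ball {R : realType} {k : scalar_kind} {n : nat}
    (d : asym_metric) (s : topology_side) (V : Gr R k n) (r : R) :
    set (Gr R k n) :=
  match s with
  | tau_minus => [set U | asym_dist d U V < r]
  | tau_plus => [set U | asym_dist d V U < r]
  end.

Definition Gr_top (R : realType) (k : scalar_kind) (n : nat)
  (d : asym_metric) (s : topology_side) : Type := Gr R k n.

HB.instance Definition _ (R : realType) (k : scalar_kind) (n : nat)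
    (d : asym_metric) (s : topology_side) :=
  Choice.copy (Gr_top R k n d s) (Gr R k n).

HB.instance Definition _ (R : realType) (k : scalar_kind) (n : nat)
    (d : asym_metric) (s : topology_side) :=
  isSubBaseTopological.Build (Gr_top R k n d s)
    [set B : set (Gr R k n) |
      exists V : Gr R k n, exists2 r : R, 0 < r & B = asym_ball d s V r] id.

Definition curve_length {R : realType} {k : scalar_kind} {n : nat}
    (d : asym_metric) (gamma : R -> Gr R k n) (A : set R) : \bar R :=
  ereal_sup
    [set (\sum_(i < (size t).-1)
            asym_dist d (gamma t`_i) (gamma t`_i.+1))%:E
    | t in [set t : seq R | sorted <%R t /\ [set` t] `<=` A]].

Definition rectifiable_curve {R : realType} {k : scalar_kind} {n : nat}
    (d : asym_metric) (gamma : R -> Gr R k n) (I : interval R) : Prop :=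
  (curve_length d gamma [set` I] < +oo)%E.

Definition has_length_change {R : realType} {k : scalar_kind} {n : nat}
    (d : asym_metric) (gamma : R -> Gr R k n) (I : interval R) (t0 : R)
    (l : \bar R) : Prop :=
  curve_length d gamma ([set` I] `&` `[t0 - delta, t0 + delta])
    @[delta --> 0^'+] --> l.

Definition projmx {R : realType} {k : scalar_kind} {n : nat}
    (V : Gr R k n) : 'M[scalars R k]_n := lin1_mx (orthoproj V).

(* Convergence of gamma(t) to L along the filter F in the usual topology of the
   Grassmannian of subspaces of the dimension of L, embedded in the square
   matrices by the orthogonal projections. *)
Definition Gr_limit {R : realType} {k : scalar_kind} {n : nat}
    (gamma : R -> Gr R k n) (F : set_system R) (L : Gr R k n) : Prop :=
  (\forall t \near F, \dim (gamma t) = \dim L) /\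
  (projmx (gamma t) @[t --> F] --> projmx L).

(* "t0 is not inf I" is stated as "I has a point below t0", for the real-valued
   infimum of the library is meaningless when I is unbounded. *)
Definition contracts_from_left_limit {R : realType} {k : scalar_kind} {n : nat}
    (gamma : R -> Gr R k n) (I : interval R) (t0 : R) (U : Gr R k n) : Prop :=
  [/\ exists2 t, t \in I & t < t0, Gr_limit gamma t0^'- U,
      (gamma t0 <= U)%VS & gamma t0 != U].

Definition contracts_to_right_limit {R : realType} {k : scalar_kind} {n : nat}
    (gamma : R -> Gr R k n) (I : interval R) (t0 : R) (W : Gr R k n) : Prop :=
  [/\ exists2 t, t \in I & t0 < t, Gr_limit gamma t0^'+ W,
      (W <= gamma t0)%VS & W != gamma t0].

Definition contracts_from_dim {R : realType} {k : scalar_kind} {n : nat}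
    (gamma : R -> Gr R k n) (I : interval R) (t0 : R) (p : nat) : Prop :=
  (exists2 U, contracts_from_left_limit gamma I t0 U & \dim U = p) \/
  ((exists W, contracts_to_right_limit gamma I t0 W) /\
     \dim (gamma t0) = p).

(* Main.v *)
Require Import Defs.
From HB Require Import structures.
From mathcomp Require Import all_boot all_order all_algebra.
From mathcomp Require Import complex.
From mathcomp Require Import all_classical all_reals all_analysis.
From mathcomp Require Import ring lra.
Import Order.TTheory GRing.Theory Num.Theory.
Import numFieldNormedType.Exports.
Local Open Scope classical_set_scope.
Local Open Scope ring_scope.

Set Implicit Arguments.
Unset Strict Implicit.
Unset Printing Implicit Defensive.

(** All nine metrics are compared with one quantity. For subspaces with
    [dim V <= dim W], the gap of [V] in [W], the least [g] with
    [|v - P_W v| <= g |v|] on [V], is the sine of the largest principal angle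
    ([principal_anglesP]); each metric lies between this sine and the sum of the
    angles, so it is small exactly when the gap is. The gap satisfies a
    triangle inequality ([near_sub_trans]) and is symmetric in equal dimensions
    ([near_sub_sym]). When [dim V > dim W] the distance is [Delta d (dim V)]; for
    nonzero [V] this constant is at least [1] and bounds every distance from [V].
    The principal angles are those of a singular value decomposition, whose
    existence comes from the diagonalization of the self-adjoint map
    [P_V P_W P_V] on [V].

    Let [V] be the value of the curve at [t0]. On each side of [t0], a partition
    that nearly exhausts the length stops short of [t0], so the length of the
    curve on a shrinking one-sided punctured neighbourhood tends to [0]. Hence:

    - distances [d (gamma s) (gamma t)] with [s < t] on one side become smaller
      than [1], so the dimension is nondecreasing in [t] there, and therefore
      constant close to [t0]; the curve is then Cauchy for the gap, and its
      orthogonal projections converge ([subspace_limit]);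

    - the length change at [t0] is the jump into [V] plus the jump out of [V]
      ([chain_sup_jump]).

    For the topology of the balls [d(., V) < r], continuity says that [gamma t] is
    almost contained in [V]. The jump into [V] is then [0] and no contraction
    comes from the left. The dimension [q] on the right is at most [dim V]: if
    [q = dim V], symmetry of the gap makes the jump out of [V] vanish; if
    [q < dim V], that jump is [Delta d (dim V)], and the right limit is a proper
    subspace of [V], a contraction. For the other topology the roles of the two
    sides are exchanged: [V] is almost contained in [gamma t], and the only possible
    contraction is the one from the left limit to [V]. *)

(** * Bounds on the nine functions of the angles *)

Section AngleBounds.
Context {R : realType}.
Implicit Types (x y : R) (th : seq R).

Definition acute x := 0 <= x <= pi / 2.

Lemma acute_cos x : acute x -> 0 <= cos x <= 1.
Proof.
case/andP=> x0 xp; rewrite cos_le1 andbT cos_ge0_pihalf // xp andbT.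
by rewrite (le_trans _ x0)// oppr_le0 divr_ge0// pi_ge0.
Qed.

Lemma acute_sin x : acute x -> 0 <= sin x <= 1.
Proof.
case/andP=> x0 xp; rewrite sin_le1 andbT sin_ge0_pi // x0.
by rewrite (le_trans xp)// ler_pdivrMr// ler_peMr ?pi_ge0// ler1n.
Qed.

Lemma sin_le_id x : 0 <= x -> sin x <= x.
Proof.
rewrite le_eqVlt => /predU1P[<-|x0]; first by rewrite sin0.
have [c _] : exists2 c, c \in `]0, x[ & sin x - sin 0 = cos c * (x - 0).
  apply: (@MVT R sin cos) => //.
  by apply: continuous_subspaceT; exact: continuous_sin.
rewrite sin0 !subr0 => ->; by rewrite ler_piMl ?cos_le1// ltW.
Qed.

Lemma half_angle x : sin (x / 2) ^+ 2 = (1 - cos x) / 2.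
Proof.
have -> : cos x = cos ((x / 2) *+ 2) by congr cos; field.
by rewrite cos_mulr2n cos2sin2; field.
Qed.

Lemma pihalf_le_pi : pi / 2 <= pi :> R.
Proof. by rewrite ler_pdivrMr// ler_peMr ?pi_ge0// ler1n. Qed.

Lemma ler_acos x y : -1 <= x -> y <= 1 -> x <= y -> acos y <= acos x.
Proof.
move=> x1 y1 xy; have yb: -1 <= y <= 1 by rewrite y1 (le_trans x1).
have xb: -1 <= x <= 1 by rewrite x1 (le_trans xy).
rewrite leNgt -ltr_cos ?in_itv /= ?acos_ge0 ?acos_lepi//.
by rewrite !acosK ?in_itv /= ?xb// -leNgt.
Qed.

Lemma acute_acos x : 0 <= x <= 1 -> acute (acos x).
Proof.
case/andP=> x0 x1; have h : -1 <= x <= 1 by rewrite x1 (le_trans _ x0)// lerN10.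
by rewrite /acute acos_ge0//= -[pi / 2]acos0 ler_acos// (le_trans _ x0)// lerN10.
Qed.

Lemma prod_cos_bound th : all acute th -> 0 <= \prod_(x <- th) cos x <= 1.
Proof.
elim: th => [_|x th IH /= /andP[/acute_cos/andP[c0 c1] /IH/andP[p0 p1]]].
  by rewrite big_nil ler01 lexx.
by rewrite big_cons mulr_ge0//= mulr_ile1.
Qed.

Lemma prod_cos_le th x : all acute th -> x \in th ->
  \prod_(y <- th) cos y <= cos x.
Proof.
elim: th => // y th IH /= /andP[/acute_cos/andP[c0 c1] ath].
have /andP[p0 p1] := prod_cos_bound ath.
rewrite big_cons inE => /predU1P[->|/(IH ath) h]; first by rewrite ler_piMr.
by apply: le_trans h; rewrite ler_piMl.
Qed.

(** The spherical distance is subadditive over independent rotations: since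
    [cos (a + b) = cos a * cos b - sin a * sin b], a product of cosines of acute
    angles dominates the cosine of their sum. *)
Lemma cos_sum_le_prod th : all acute th -> \sum_(x <- th) x <= pi / 2 ->
  cos (\sum_(x <- th) x) <= \prod_(x <- th) cos x.
Proof.
elim: th => [_ _|x th IH /= /andP[ax ath]]; first by rewrite !big_nil cos0.
have s0 : 0 <= \sum_(y <- th) y.
  by rewrite big_seq sumr_ge0// => y /(allP ath)/andP[].
case/andP: (ax) => x0 xp; rewrite !big_cons => sp.
have sp' : \sum_(y <- th) y <= pi / 2 by lra.
have/andP[sx _] := acute_sin ax; have/andP[cx _] := acute_cos ax.
have/andP[ss _] : 0 <= sin (\sum_(y <- th) y) <= 1.
  by apply: acute_sin; rewrite /acute s0.
rewrite cosD; apply: (@le_trans _ _ (cos x * cos (\sum_(y <- th) y))).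
  by rewrite gerBl mulr_ge0.
by apply: ler_wpM2l => //; exact: IH.
Qed.

Lemma last_mem th : th != [::] -> last 0 th \in th.
Proof. by case: th => // x th _; rewrite /= mem_last. Qed.

Lemma le_sum_mem (f : R -> R) th x : (forall y, y \in th -> 0 <= f y) -> x \in th ->
  f x <= \sum_(y <- th) f y.
Proof.
move=> f0 /[dup] xth /perm_to_rem/(perm_big _) -> /=; rewrite big_cons lerDl.
by rewrite big_seq sumr_ge0// => y /mem_rem; exact: f0.
Qed.

Lemma sum_le_size (f : R -> R) (c : R) th : (forall y, y \in th -> f y <= c) ->
  \sum_(y <- th) f y <= (size th)%:R * c.
Proof.
move=> fc; rewrite big_seq (le_trans (ler_sum _ fc))// -big_seq.
by rewrite big_const_seq count_predT iter_addr_0 mulr_natl.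
Qed.

Lemma sqrt_sum_sqr_le (f : R -> R) th : (forall y, y \in th -> 0 <= f y) ->
  Num.sqrt (\sum_(y <- th) f y ^+ 2) <= \sum_(y <- th) f y.
Proof.
move=> f0; have s0 : 0 <= \sum_(y <- th) f y by rewrite big_seq sumr_ge0.
rewrite -[leRHS]ger0_norm// -sqrtr_sqr; apply: ler_wsqrtr.
elim: th f0 {s0} => [_|x th IH f0]; first by rewrite !big_nil expr0n.
have f0' y : y \in th -> 0 <= f y by move=> h; apply: f0; rewrite inE h orbT.
have s0 : 0 <= \sum_(y <- th) f y by rewrite big_seq sumr_ge0.
have := IH f0'; have := f0 x (mem_head _ _); rewrite !big_cons; nra.
Qed.

(** The Fubini-Study angle is at most the sum of the angles by
    [cos_sum_le_prod]; the chordal wedge and Binet-Cauchy distances are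
    [2 sin (phi / 2)] and [sin phi] for that angle [phi]. *)
Lemma angle_dist_le_sum d th : all acute th -> th != [::] ->
  angle_dist d th <= \sum_(x <- th) x.
Proof.
move=> ath th0; have aP y : y \in th -> acute y by exact: (allP ath).
have y0 y : y \in th -> 0 <= y by case/aP/andP.
have sin0y y : y \in th -> 0 <= sin y by case/aP/acute_sin/andP.
have ahalf y : acute y -> acute (y / 2) by rewrite /acute; lra.
have shalf y : y \in th -> 0 <= sin (y / 2).
  by move=> /aP/ahalf/acute_sin/andP[].
have lth := last_mem th0; have ll := @le_sum_mem id _ _ y0 lth.
have s0 : 0 <= \sum_(y <- th) y by rewrite big_seq sumr_ge0.
have /andP[p0 p1] := prod_cos_bound ath.
have pN1 : -1 <= \prod_(x <- th) cos x by lra.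
have pb : -1 <= \prod_(x <- th) cos x <= 1 by rewrite pN1.
set phi := acos (\prod_(x <- th) cos x).
have aphi : acute phi by apply: acute_acos; rewrite p0.
have cphi : cos phi = \prod_(x <- th) cos x by rewrite acosK// in_itv /= pb.
have phi0 : 0 <= phi by case/andP: aphi.
have phile : phi <= \sum_(x <- th) x.
  case: (leP (\sum_(x <- th) x) (pi / 2)) => [sp|/ltW]; last first.
    by apply: le_trans; case/andP: aphi.
  have := cos_sum_le_prod ath sp; rewrite -cphi leNgt => h; rewrite leNgt.
  apply: contra h => sphi; rewrite ltr_cos ?in_itv /= ?s0 ?phi0//=.
    exact: le_trans sp pihalf_le_pi.
  by case/andP: aphi => _ /le_trans; apply; exact: pihalf_le_pi.
case: d => /=.
- exact: sqrt_sum_sqr_le.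
- apply: (@le_trans _ _ (2 * \sum_(x <- th) sin (x / 2))).
    by apply: ler_wpM2l => //; exact: sqrt_sum_sqr_le.
  rewrite mulr_sumr big_seq [leRHS]big_seq; apply: ler_sum => x /y0 x0.
  have := @sin_le_id (x / 2); lra.
- apply: le_trans (sqrt_sum_sqr_le sin0y) _.
  by rewrite big_seq [leRHS]big_seq; apply: ler_sum => x /y0/sin_le_id.
- exact: phile.
- apply: le_trans phile; rewrite -cphi.
  rewrite -[leRHS]ger0_norm// -sqrtr_sqr; apply: ler_wsqrtr.
  have := half_angle phi; have /andP[+ _] := acute_sin (ahalf _ aphi).
  have := @sin_le_id (phi / 2); nra.
- apply: le_trans phile; rewrite prodrXl -cphi -sin2cos2 sqrtr_sqr ger0_norm.
    exact: sin_le_id.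
  by case/andP: (acute_sin aphi).
- exact: ll.
- have := y0 _ lth; have := @sin_le_id (last 0 th / 2); lra.
- by apply: le_trans ll; apply: sin_le_id; exact: y0.
Qed.

Lemma angle_dist_le_Delta d th : all acute th -> th != [::] ->
  angle_dist d th <= Delta d (size th).
Proof.
move=> ath th0; have aP y : y \in th -> acute y by exact: (allP ath).
have /andP[p0 p1] := prod_cos_bound ath.
have lth := last_mem th0.
have sq_half y : y \in th -> sin (y / 2) ^+ 2 <= 1 / 2.
  by move=> /aP/acute_cos; have := half_angle y; lra.
have sqb y : y \in th -> sin y ^+ 2 <= 1 by move=> /aP/acute_sin; nra.
have al : acute (last 0 th) by exact: aP.
case: d => /=.
- have pi20 : 0 <= pi / 2 :> R by rewrite divr_ge0// pi_ge0.
  rewrite -[X in X * _]ger0_norm// -sqrtr_sqr -sqrtrM ?sqr_ge0//.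
  apply: ler_wsqrtr; rewrite mulrC; apply: (@sum_le_size (fun y => y ^+ 2)) => y /aP /andP[]; nra.
- rewrite -[X in X * Num.sqrt _]ger0_norm// -sqrtr_sqr -sqrtrM ?sqr_ge0//.
  by apply: ler_wsqrtr; have := sum_le_size sq_half; lra.
- by apply: ler_wsqrtr; have := sum_le_size sqb; lra.
- by have := @acute_acos (\prod_(x <- th) cos x); rewrite p0 p1 => /(_ isT)/andP[].
- by apply: ler_wsqrtr; lra.
- rewrite -[leRHS]sqrtr1; apply: ler_wsqrtr.
  by rewrite prodrXl gerBl sqr_ge0.
- by case/andP: al.
- rewrite -[X in X * sin _]ger0_norm// -sqrtr_sqr.
  have s0 : 0 <= sin (last 0 th / 2).
    by case/andP: al => x0 x1; apply: sin_ge0_pi; rewrite divr_ge0//=; have := pihalf_le_pi; lra.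
  rewrite -[sin _]ger0_norm// -sqrtr_sqr -sqrtrM ?sqr_ge0//; apply: ler_wsqrtr.
  by have := sq_half _ lth; lra.
- by case/andP: (acute_sin al).
Qed.

(** Each function is at least its value on the largest angle alone, and for a single
    angle [x] it is one of [x], [2 sin (x / 2)] and [sin x]. *)
Lemma sin_last_le_angle_dist d th : all acute th -> th != [::] ->
  sin (last 0 th) <= angle_dist d th.
Proof.
move=> ath th0; have aP y : y \in th -> acute y by exact: (allP ath).
have /andP[p0 p1] := prod_cos_bound ath.
have lth := last_mem th0; have al : acute (last 0 th) by exact: aP.
have pl := prod_cos_le ath lth.
set x := last 0 th in lth al pl *.
case/andP: (al) => x0 xpi; have sx := sin_le_id x0.
have /andP[s0 s1] := acute_sin al; have /andP[c0 c1] := acute_cos al.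
have ah : acute (x / 2) by rewrite /acute; lra.
have /andP[sh0 sh1] := acute_sin ah; have /andP[ch0 ch1] := acute_cos ah.
have schord : sin x <= 2 * sin (x / 2).
  have -> : sin x = sin ((x / 2) *+ 2) by congr sin; field.
  by rewrite sin_mulr2n; nra.
have le_sqrt (f : R -> R) : 0 <= f x -> f x <= Num.sqrt (\sum_(y <- th) f y ^+ 2).
  move=> f0; rewrite -[leLHS]ger0_norm// -sqrtr_sqr; apply: ler_wsqrtr.
  by apply: (@le_sum_mem (fun y => f y ^+ 2)) => // y _; exact: sqr_ge0.
case: d => /=.
- exact: le_trans sx (@le_sqrt id x0).
- apply: le_trans schord _; apply: ler_wpM2l => //.
  exact: (@le_sqrt (fun y => sin (y / 2))).
- exact: (@le_sqrt sin).
- apply: le_trans sx _; rewrite -[leLHS]cosK ?in_itv/= ?x0 ?(le_trans xpi pihalf_le_pi)//.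
  by apply: ler_acos => //; lra.
- apply: le_trans schord _; rewrite -[leLHS]ger0_norm ?mulr_ge0// -sqrtr_sqr.
  by apply: ler_wsqrtr; have := half_angle x; nra.
- rewrite -[leLHS]ger0_norm// -sqrtr_sqr; apply: ler_wsqrtr.
  by rewrite prodrXl sin2cos2 lerB// ler_sqr ?nnegrE.
- exact: sx.
- exact: schord.
- exact: lexx.
Qed.

Lemma Delta_ge1 d p : (0 < p)%N -> 1 <= Delta d p :> R.
Proof.
move=> p0; have p1 : 1 <= p%:R :> R by rewrite ler1n.
have sp : 1 <= Num.sqrt p%:R :> R by rewrite -[leLHS]sqrtr1 ler_wsqrtr.
have s2 : 1 <= Num.sqrt 2 :> R by rewrite -[leLHS]sqrtr1 ler_wsqrtr// ler1n.
have := @pihalf_ge1 R; case: d => //= h; first exact: mulr_ege1.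
by rewrite -[leLHS]sqrtr1 ler_wsqrtr//; lra.
Qed.

Lemma Delta_le d p q : (p <= q)%N -> Delta d p <= Delta d q :> R.
Proof.
rewrite -(ler_nat R) => pq; case: d => //=; last exact: ler_wsqrtr.
  by rewrite ler_wpM2l ?divr_ge0 ?pi_ge0// ler_wsqrtr.
by rewrite ler_wsqrtr// ler_wpM2l.
Qed.

End AngleBounds.

(** * The real inner product of a real or complex space *)

Section RealInner.
Context {R : realType} {k : scalar_kind}.

(** Metric arguments only need the real part of the inner product, a Euclidean
    inner product on the underlying real space; using it makes them uniform in
    the two scalar fields. *)
Definition re {k} : scalars R k -> R :=
  match k return scalars R k -> R with
  | real_scalars => id
  | complex_scalars => @complex.Re R
  end.

Lemma reD (x y : scalars R k) : re (x + y) = re x + re y.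
Proof. by case: k x y => //= -[a b] [c e]. Qed.

Lemma reN (x : scalars R k) : re (- x) = - re x.
Proof. by case: k x => //= -[a b]. Qed.

Lemma re0 : re (0 : scalars R k) = 0.
Proof. by case: k. Qed.

Lemma re_of_realM (a : R) (x : scalars R k) : re (of_real k a * x) = a * re x.
Proof. by case: k x => //= -[b c]; rewrite /= mul0r subr0. Qed.

Lemma re_of_real (a : R) : re (of_real k a) = a.
Proof. by case: k. Qed.

Lemma re_conjF (x : scalars R k) : re (conjF x) = re x.
Proof. by case: k x => //= -[]. Qed.

Lemma ge0_of_real (x : scalars R k) : 0 <= x -> x = of_real k (re x).
Proof. by case: k x => //= -[a b]; rewrite lecE /= => /andP[/eqP -> _]. Qed.

Lemma re_ge0 (x : scalars R k) : 0 <= x -> 0 <= re x.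
Proof. by case: k x => //= -[a b]; rewrite lecE /= => /andP[]. Qed.

Lemma conj_of_real (a : R) : conjF (of_real k a) = of_real k a.
Proof. by case: k => //=; rewrite /real_complex_def/= oppr0. Qed.

Context {n : nat}.
Implicit Types (u v w : vec R k n) (a : R).

Local Notation "<| u , v |>" := (inner u v).

Lemma innerC u v : inner u v = conjF (inner v u).
Proof. by rewrite inner_hermitian expr0 mul1r. Qed.

Lemma innerDl u v w : inner (u + v) w = inner u w + inner v w.
Proof. exact: linearDl. Qed.

Lemma innerZl c u w : inner (c *: u) w = c * inner u w.
Proof. exact: linearZl. Qed.

Lemma innerDr u v w : inner w (u + v) = inner w u + inner w v.
Proof. exact: linearDr. Qed.

Lemma innerBl u v w : inner (u - v) w = inner u w - inner v w.
Proof. exact: linearBl. Qed.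

Lemma innerBr u v w : inner w (u - v) = inner w u - inner w v.
Proof. exact: linearBr. Qed.

Lemma innerZr c u w : inner w (c *: u) = conjF c * inner w u.
Proof. by rewrite innerC innerZl rmorphM -innerC. Qed.

Lemma inner0l u : inner 0 u = 0. Proof. exact: linear0l. Qed.
Lemma inner0r u : inner u 0 = 0. Proof. exact: linear0r. Qed.

Lemma inner_suml I (r : seq I) (P : pred I) (f : I -> vec R k n) w :
  inner (\sum_(i <- r | P i) f i) w = \sum_(i <- r | P i) inner (f i) w.
Proof. by apply: (big_morph (fun u => inner u w)) => [x y|]; rewrite ?innerDl ?inner0l. Qed.

Definition rinner u v : R := re (inner u v).
Definition sqnorm u : R := rinner u u.
Definition vnorm u : R := Num.sqrt (sqnorm u).

Lemma inner_ge0 u : 0 <= inner u u.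
Proof.
by case: (eqVneq u 0) => [->|/inner_gt0/ltW//]; rewrite inner0l.
Qed.

Lemma inner_sqnorm u : inner u u = of_real k (sqnorm u).
Proof. exact/ge0_of_real/inner_ge0. Qed.

Lemma sqnorm_ge0 u : 0 <= sqnorm u.
Proof. exact/re_ge0/inner_ge0. Qed.

Lemma sqnorm_eq0 u : sqnorm u = 0 -> u = 0.
Proof.
move=> u0; apply: contraTeq (lexx (0 : scalars R k)) => /inner_gt0.
by rewrite inner_sqnorm u0 rmorph0 ltxx.
Qed.

Lemma inner_eq0 u : inner u u = 0 -> u = 0.
Proof. by move=> h; apply: sqnorm_eq0; rewrite /sqnorm /rinner h re0. Qed.

Lemma rinnerC u v : rinner u v = rinner v u.
Proof. by rewrite /rinner innerC re_conjF. Qed.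

Lemma rinnerDl u v w : rinner (u + v) w = rinner u w + rinner v w.
Proof. by rewrite /rinner innerDl reD. Qed.

Lemma rinnerBl u v w : rinner (u - v) w = rinner u w - rinner v w.
Proof. by rewrite /rinner innerBl reD reN. Qed.

Lemma rinnerDr u v w : rinner w (u + v) = rinner w u + rinner w v.
Proof. by rewrite /rinner innerDr reD. Qed.

Lemma rinnerBr u v w : rinner w (u - v) = rinner w u - rinner w v.
Proof. by rewrite /rinner innerBr reD reN. Qed.

Lemma rinnerZl a u v : rinner (of_real k a *: u) v = a * rinner u v.
Proof. by rewrite /rinner innerZl re_of_realM. Qed.

Lemma rinnerZr a u v : rinner u (of_real k a *: v) = a * rinner u v.
Proof. by rewrite rinnerC rinnerZl rinnerC. Qed.

Lemma sqnormZ a u : sqnorm (of_real k a *: u) = a ^+ 2 * sqnorm u.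
Proof. by rewrite /sqnorm rinnerZl rinnerZr mulrA. Qed.

Lemma sqnormD u v : sqnorm (u + v) = sqnorm u + 2 * rinner u v + sqnorm v.
Proof. by rewrite /sqnorm rinnerDl !rinnerDr (rinnerC v u); ring. Qed.

Lemma vnorm_ge0 u : 0 <= vnorm u. Proof. exact: sqrtr_ge0. Qed.

Lemma sqr_vnorm u : vnorm u ^+ 2 = sqnorm u.
Proof. by rewrite sqr_sqrtr ?sqnorm_ge0. Qed.

Lemma vnorm_eq0 u : vnorm u = 0 -> u = 0.
Proof. by move=> h; apply: sqnorm_eq0; rewrite -sqr_vnorm h expr0n. Qed.

Lemma vnorm0 : vnorm 0 = 0.
Proof. by rewrite /vnorm /sqnorm /rinner inner0l re0 sqrtr0. Qed.

Lemma vnormN u : vnorm (- u) = vnorm u.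
Proof.
rewrite /vnorm; congr Num.sqrt.
have -> : - u = of_real k (-1) *: u by rewrite rmorphN1 scaleN1r.
by rewrite sqnormZ sqrrN expr1n mul1r.
Qed.

(** Expand the squared norm of [|v|^2 u - <u, v> v]. *)
Lemma cauchy_schwarz u v : rinner u v <= vnorm u * vnorm v.
Proof.
case: (eqVneq v 0) => [->|v0].
  by rewrite /rinner inner0r re0 mulr_ge0 ?vnorm_ge0.
have sv : 0 < sqnorm v.
  by rewrite lt_neqAle sqnorm_ge0 andbT eq_sym; apply: contra_neq v0 => /sqnorm_eq0.
have := sqnorm_ge0 (of_real k (sqnorm v) *: u + of_real k (- rinner u v) *: v).
rewrite sqnormD !sqnormZ rinnerZl rinnerZr => h.
have {}h : 0 <= sqnorm v * (sqnorm v * sqnorm u - rinner u v ^+ 2) by lra.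
rewrite pmulr_rge0// subr_ge0 -!sqr_vnorm in h.
have := vnorm_ge0 u; have := vnorm_ge0 v => nv nu.
apply: le_trans (ler_norm _) _; rewrite -sqrtr_sqr.
rewrite -[leRHS]ger0_norm ?mulr_ge0// -sqrtr_sqr; apply: ler_wsqrtr.
by rewrite exprMn mulrC.
Qed.

Lemma vnorm_triangle u v : vnorm (u + v) <= vnorm u + vnorm v.
Proof.
have nu := vnorm_ge0 u; have nv := vnorm_ge0 v; have := cauchy_schwarz u v.
have s0 := addr_ge0 nu nv; rewrite -[X in _ -> _ <= X]ger0_norm// -sqrtr_sqr => cs; apply: ler_wsqrtr.
by rewrite sqnormD -!sqr_vnorm; lra.
Qed.

Lemma le_vnorm u v : sqnorm u <= sqnorm v -> vnorm u <= vnorm v.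
Proof. exact: ler_wsqrtr. Qed.

End RealInner.

(** * Eigenvectors of self-adjoint maps *)

Section SpectralTheorem.
Context {R : realType} {k : scalar_kind} {n : nat}.
Implicit Types (u v w : vec R k n) (V : Gr R k n) (S : 'End(vec R k n)).

Definition selfadjoint S := forall u v, inner (S u) v = inner u (S v).

(** Coordinates on [V]: [f] maps row vectors to combinations of a basis of [V], and
    [M] is the matrix of [S] there. *)
Lemma matrix_of_stable S V : (S @: V <= V)%VS -> V != 0%VS ->
  exists m (M : 'M[scalars R k]_m) (f : 'rV[scalars R k]_m -> vec R k n),
    [/\ (0 < m)%N, forall x, f x = 0 -> x = 0, forall x, f x \in V,
        (forall c x y, f (c *: x + y) = c *: f x + f y) &
        forall x, S (f x) = f (x *m M)].
Proof.
move=> SV V0; pose b := vbasis V.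
exists (\dim V), (\matrix_(i, j) coord b j (S b`_i)),
  (fun x : 'rV_(\dim V) => \sum_i x 0 i *: b`_i); split.
- by rewrite lt0n dimv_eq0.
- move=> x fx0; apply/rowP => j; rewrite mxE.
  have /freeP := basis_free (vbasisP V); apply => //.
- by move=> x; apply: memv_suml => i _; rewrite memvZ// vbasis_mem// mem_nth ?size_tuple.
- move=> c x y; rewrite scaler_sumr -big_split/=; apply: eq_bigr => i _.
  by rewrite !mxE scalerDl scalerA.
- move=> x; rewrite linear_sum/=.
  under [RHS]eq_bigr => j _ do rewrite mxE scaler_suml.
  rewrite exchange_big/=; apply: eq_bigr => i _.
  rewrite linearZ/=.
  have Sb : S b`_i \in V.
    by apply: (subvP SV); rewrite memv_img// vbasis_mem// mem_nth ?size_tuple.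
  rewrite {1}(coord_vbasis Sb) scaler_sumr; apply: eq_bigr => j _.
  by rewrite mxE scalerA.
Qed.
End SpectralTheorem.

Lemma selfadjoint_eigenvector_complex (R : realType) (n : nat)
    (S : 'End(vec R complex_scalars n)) (V : Gr R complex_scalars n) :
  selfadjoint S -> (S @: V <= V)%VS -> V != 0%VS ->
  exists a : R, exists v,
    [/\ v \in V, v != 0 & S v = of_real complex_scalars a *: v].
Proof.
move=> SA SV V0; have [m [M [f [m0 f0 fV flin fM]]]] := matrix_of_stable SV V0.
have [a /eigenvalueP[x xM x0]] := @eigenvalue_closed R[i] m M m0.
have f00 : f 0 = 0 by have := flin (-1) 0 0; rewrite scaler0 addr0 scaleN1r addNr.
have Sx : S (f x) = a *: f x.
  by rewrite fM xM -[a *: x]addr0 flin f00 addr0.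
have fx0 : f x != 0 by apply: contra_neq x0; exact: f0.
exists (re (k := complex_scalars) a); exists (f x); split => //.
rewrite Sx; congr (_ *: _).
have := SA (f x) (f x); rewrite Sx innerZl innerZr => /mulIf h.
have {}h : a = conjc a by apply: h; rewrite gt_eqF// inner_gt0.
by case: a h {xM Sx} => a b [] bN; rewrite /= /real_complex_def /=; congr Complex; lra.
Qed.

(** The matrix of [S] has a complex eigenvalue [al + i be] with eigenvector
    [x + i y], so that [S x = al x - be y] and [S y = al y + be x]. Comparing
    [<S x, y>] with [<x, S y>] gives [be (|x|^2 + |y|^2) = 0]. *)
Lemma selfadjoint_eigenvector_real (R : realType) (n : nat)
    (S : 'End(vec R real_scalars n)) (V : Gr R real_scalars n) :
  selfadjoint S -> (S @: V <= V)%VS -> V != 0%VS ->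
  exists a : R, exists v,
    [/\ v \in V, v != 0 & S v = of_real real_scalars a *: v].
Proof.
move=> SA SV V0; have [m [M [f [m0 f0 fV flin fM]]]] := matrix_of_stable SV V0.
have [a /eigenvalueP[z zM z0]] :=
  @eigenvalue_closed R[i] m (map_mx (real_complex R) M) m0.
pose x : 'rV[R]_m := map_mx (@complex.Re R) z.
pose y : 'rV[R]_m := map_mx (@complex.Im R) z.
have ReS (F : 'I_m -> R[i]) : complex.Re (\sum_i F i) = \sum_i complex.Re (F i).
  by apply: big_morph => // -[? ?] [].
have ImS (F : 'I_m -> R[i]) : complex.Im (\sum_i F i) = \sum_i complex.Im (F i).
  by apply: big_morph => // -[? ?] [].
case: a zM => al be zM.
have xM : x *m M = al *: x - be *: y.
  apply/rowP => j; have /rowP/(_ j)/(congr1 (@complex.Re R)) := zM.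
  rewrite !mxE ReS => h.
  transitivity (al * complex.Re (z 0 j) - be * complex.Im (z 0 j)); last first.
    by [].
  move: h; case: (z 0 j) => a b /= <-; apply: eq_bigr => i _.
  by rewrite !mxE; case: (z 0 i) => c e /=; rewrite mulr0 subr0.
have yM : y *m M = al *: y + be *: x.
  apply/rowP => j; have /rowP/(_ j)/(congr1 (@complex.Im R)) := zM.
  rewrite !mxE ImS => h.
  transitivity (al * complex.Im (z 0 j) + be * complex.Re (z 0 j)); last first.
    by [].
  move: h; case: (z 0 j) => a b /= <-; apply: eq_bigr => i _.
  by rewrite !mxE; case: (z 0 i) => c e /=; rewrite mulr0 add0r.
have f00 : f 0 = 0 by have := flin (-1) 0 0; rewrite scaler0 addr0 scaleN1r addNr.
have fZ c u : f (c *: u) = c *: f u by rewrite -[c *: u]addr0 flin f00 addr0.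
have fD u v : f (u + v) = f u + f v by rewrite -[u]scale1r flin !scale1r.
have Sx : S (f x) = al *: f x - be *: f y by rewrite fM xM fD -scaleNr !fZ scaleNr.
have Sy : S (f y) = al *: f y + be *: f x by rewrite fM yM fD !fZ.
have xy0 : (f x != 0) || (f y != 0).
  rewrite -negb_and; apply: contra z0 => /andP[/eqP/f0 x0 /eqP/f0 y0].
  apply/eqP/rowP => j; have /rowP/(_ j) := x0; have /rowP/(_ j) := y0; rewrite !mxE.
  by case: (z 0 j) => c e /= -> ->.
have be0 : be = 0.
  have := SA (f x) (f y); rewrite Sx Sy innerBl innerDr !innerZl !innerZr /=.
  have alg (p q r : R) : al * p - be * q = al * p + be * r -> be * (r + q) = 0 by lra.
  move=> /alg /eqP.
  rewrite mulf_eq0 => /orP[/eqP//|].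
  move=> /eqP h; have {}h : sqnorm (f x) + sqnorm (f y) = 0 := h.
  have p := sqnorm_ge0 (f x); have q := sqnorm_ge0 (f y).
  have /sqnorm_eq0 x0 : sqnorm (f x) = 0 by lra.
  have /sqnorm_eq0 y0 : sqnorm (f y) = 0 by lra.
  by rewrite x0 y0 eqxx in xy0.
rewrite be0 in Sx Sy; exists al; case/orP: xy0 => ?.
  by exists (f x); split => //; rewrite Sx scale0r subr0.
by exists (f y); split => //; rewrite Sy scale0r addr0.
Qed.

(** * Orthonormal bases and diagonalization *)

Section OrthonormalBases.
Context {R : realType} {k : scalar_kind} {n : nat}.
Implicit Types (u v w : vec R k n) (V W : Gr R k n) (e f : seq (vec R k n)).

Local Notation orthonormal := (orthonormal (@inner R k n)).

Lemma orthonormal_cons v e : orthonormal (v :: e) =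
  [&& inner v v == 1, all (fun u => inner v u == 0) e & orthonormal e].
Proof.
by rewrite /orthonormal /= andbT -!andbA; congr andb; rewrite andbCA.
Qed.

Lemma orthonormal_nth e i j : orthonormal e -> (i < size e)%N -> (j < size e)%N ->
  inner e`_i e`_j = (i == j)%:R.
Proof.
elim: e i j => // v e IH i j; rewrite orthonormal_cons => /and3P[/eqP vv /allP ve oe].
case: i j => [|i] [|j]; rewrite ?ltnS /= => iV jV.
- by rewrite vv.
- by apply/eqP; rewrite ve// mem_nth.
- by rewrite innerC (eqP (ve _ _)) ?mem_nth// rmorph0.
- by rewrite IH// eqSS.
Qed.

Lemma orthonormalPn e : (forall i j, (i < size e)%N -> (j < size e)%N ->
  inner e`_i e`_j = (i == j)%:R) -> orthonormal e.
Proof.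
elim: e => // v e IH h; rewrite orthonormal_cons; apply/and3P; split.
- by apply/eqP; exact: (h 0%N 0%N).
- by apply/(all_nthP 0) => i ie; apply/eqP; exact: (h 0%N i.+1).
- by apply: IH => i j iV jV; exact: (h i.+1 j.+1).
Qed.

Lemma inner_comb e m (c : nat -> scalars R k) j : orthonormal e ->
  (m <= size e)%N -> (j < m)%N -> inner (\sum_(i < m) c i *: e`_i) e`_j = c j.
Proof.
move=> oe me jm; have lt_e i : (i < m)%N -> (i < size e)%N by move/leq_trans; apply.
rewrite inner_suml (bigD1 (Ordinal jm))//= innerZl.
rewrite orthonormal_nth ?lt_e// eqxx mulr1 big1 ?addr0// => i ij.
by rewrite innerZl orthonormal_nth ?lt_e// (negbTE (_ : i != j :> nat)) ?mulr0.
Qed.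

Lemma sqnorm_comb e m (c : nat -> scalars R k) : orthonormal e ->
  (m <= size e)%N ->
  sqnorm (\sum_(i < m) c i *: e`_i) = \sum_(i < m) re (c i * conjF (c i)).
Proof.
move=> oe me; rewrite /sqnorm /rinner inner_suml.
rewrite (big_morph _ reD re0); apply: eq_bigr => i _.
by rewrite innerZl [in LHS]innerC inner_comb.
Qed.

Lemma orthonormal_free e : orthonormal e -> free e.
Proof.
move=> oe; suff : free (in_tuple e) by []. apply/freeP => c c0 j.
have := @inner_comb e (size e) (fun i => if insub i is Some i' then c i' else 0) j
  oe (leqnn _) (ltn_ord j).
rewrite valK => <-; rewrite -[RHS](inner0l e`_j); congr (inner _ _).
by rewrite -[RHS]c0; apply: eq_bigr => i _; rewrite valK.
Qed.

Lemma orthonormal_memP e : reflect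
  (uniq e /\ {in e &, forall u v, inner u v = (u == v)%:R}) (orthonormal e).
Proof.
apply: (iffP idP) => [oe|[ue h]].
  have ue : uniq e by exact/free_uniq/orthonormal_free.
  split=> // u v ue' ve'; rewrite -{1}(nth_index 0 ue') -{1}(nth_index 0 ve').
  rewrite orthonormal_nth ?index_mem//; congr (nat_of_bool _)%:R.
  apply/eqP/eqP => [iuv|->//].
  by rewrite -(nth_index 0 ue') iuv nth_index.
by apply: orthonormalPn => i j ie je; rewrite h ?mem_nth// nth_uniq.
Qed.

Lemma orthonormal_perm e f : perm_eq e f -> orthonormal e -> orthonormal f.
Proof.
move=> ef /orthonormal_memP[ue h]; apply/orthonormal_memP.
by split=> [|u v]; rewrite -?(perm_uniq ef)// -!(perm_mem ef); exact: h.
Qed.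

Definition onb V e := basis_of V e && orthonormal e.

Lemma onb_nil : onb 0 [::].
Proof. by rewrite /onb nil_basis. Qed.

Lemma onb_size V e : onb V e -> size e = \dim V.
Proof. by case/andP=> /andP[/eqP <- /eqP ->]. Qed.

Lemma onb_mem V e v : onb V e -> v \in e -> v \in V.
Proof. by case/andP=> be _; exact: basis_mem. Qed.

Lemma onb_nth V e i j : onb V e -> (i < \dim V)%N -> (j < \dim V)%N ->
  inner e`_i e`_j = (i == j)%:R.
Proof.
by move=> oe; rewrite -(onb_size oe) => iV jV; case/andP: oe => _ oe; exact: orthonormal_nth.
Qed.

Lemma onbP V e : orthonormal e -> {subset e <= V} -> size e = \dim V -> onb V e.
Proof.
move=> oe eV se; rewrite /onb oe andbT basisEfree orthonormal_free// se leqnn andbT.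
exact/span_subvP.
Qed.

(** Both the spectral theorem and the extension of orthonormal families go by
    induction on the dimension, splitting off one unit vector. *)
Lemma onb_cons V v e : v \in V -> inner v v = 1 ->
  onb (V :&: orthov (@inner R k n) <[v]>) e -> onb V (v :: e).
Proof.
move=> vV vv oe; have vd : v \notin orthov (@inner R k n) V.
  by apply/mem_orthovPn; exists v => //; rewrite /= vv oner_eq0.
apply: onbP.
- rewrite orthonormal_cons vv eqxx /=; case/andP: (oe) => _ ->; rewrite andbT.
  apply/allP => u /(onb_mem oe); rewrite memv_cap mem_orthov1 => /andP[_ /eqP uv].
  by rewrite innerC uv rmorph0.
- move=> u; rewrite inE => /predU1P[->//|/(onb_mem oe)].
  by rewrite memv_cap => /andP[].
- rewrite /= (onb_size oe) -eq_dim_orthov1// prednK// lt0n dimv_eq0.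
  apply: contraTneq vV => ->; rewrite memv0; apply: contra_eqN vv => /eqP ->.
  by rewrite inner0l eq_sym oner_eq0.
Qed.

Lemma unit_vector v : v != 0 ->
  inner (of_real k (vnorm v)^-1 *: v) (of_real k (vnorm v)^-1 *: v) = 1.
Proof.
move=> v0; rewrite inner_sqnorm sqnormZ -sqr_vnorm -exprMn mulVf ?expr1n ?rmorph1//.
by apply: contra_neq v0; exact: vnorm_eq0.
Qed.

Lemma selfadjoint_eigenvector (S : 'End(vec R k n)) V :
  selfadjoint S -> (S @: V <= V)%VS -> V != 0%VS ->
  exists a : R, exists v, [/\ v \in V, v != 0 & S v = of_real k a *: v].
Proof.
by case: k S V; [exact: selfadjoint_eigenvector_real|exact: selfadjoint_eigenvector_complex].
Qed.

Lemma selfadjoint_onb (S : 'End(vec R k n)) V :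
  selfadjoint S -> (S @: V <= V)%VS ->
  exists2 e, onb V e & forall v, v \in e -> exists a : R, S v = of_real k a *: v.
Proof.
move=> SA; have [m] := ubnP (\dim V); elim: m V => // m IH V dV SV.
case: (eqVneq V 0%VS) => [->|V0]; first by exists [::] => //; exact: onb_nil.
have [a [v [vV v0 Sv]]] := selfadjoint_eigenvector SA SV V0.
pose v1 := of_real k (vnorm v)^-1 *: v.
have v1V : v1 \in V by exact: memvZ.
have v11 : inner v1 v1 = 1 by exact: unit_vector.
have Sv1 : S v1 = of_real k a *: v1 by rewrite linearZ/= Sv !scalerA mulrC.
have vd : v1 \notin orthov (@inner R k n) V.
  by apply/mem_orthovPn; exists v1 => //; rewrite /= v11 oner_eq0.
have [||e oe eS] := IH (V :&: orthov (@inner R k n) <[v1]>)%VS.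
- rewrite -eq_dim_orthov1//; have : (0 < \dim V)%N by rewrite lt0n dimv_eq0.
  by move: dV; case: (\dim V).
- apply/subvP => _ /memv_imgP[u + ->]; rewrite !memv_cap !mem_orthov1 => /andP[uV /eqP uv].
  rewrite (subvP SV) ?memv_img//= SA Sv1 innerZr uv mulr0 eqxx//.
exists (v1 :: e); first exact: onb_cons.
by move=> u; rewrite inE => /predU1P[->|/eS//]; exists a.
Qed.

(** Diagonalize the identity. *)
Lemma onb_exists V : exists e, onb V e.
Proof.
have [||e oe _] := @selfadjoint_onb \1%VF V; last by exists e.
  by move=> u v; rewrite !lfunE.
by rewrite lim1g.
Qed.

Lemma onb_extend V f : orthonormal f -> {subset f <= V} ->
  exists g, onb V (f ++ g).
Proof.
elim: f V => [V _ _|v f IH V]; first exact: onb_exists.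
rewrite orthonormal_cons => /and3P[/eqP vv /allP vf of_] fV.
have [||g og] := IH (V :&: orthov (@inner R k n) <[v]>)%VS => //.
  move=> u uf; rewrite memv_cap fV ?inE ?uf ?orbT//= mem_orthov1 /= innerC.
  by rewrite (eqP (vf _ uf)) rmorph0.
by exists g; apply: onb_cons; rewrite ?fV ?mem_head.
Qed.

Lemma onb_perm V e f : perm_eq e f -> onb V e -> onb V f.
Proof.
move=> ef oe; apply: onbP.
- by apply: orthonormal_perm ef _; case/andP: oe.
- by move=> u; rewrite -(perm_mem ef); exact: onb_mem.
- by rewrite -(perm_size ef); exact: onb_size.
Qed.

Lemma onb_expand V e v : onb V e -> v \in V ->
  v = \sum_(i < \dim V) inner v e`_i *: e`_i.
Proof.
move=> oe vV; have se := onb_size oe; case/andP: (oe) => /andP[/eqP eV _] oe'.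
have : v \in <<in_tuple e>>%VS by rewrite /= eV.
move=> /coord_span; set c := fun i : nat => if insub i is Some i' then coord (in_tuple e) i' v else 0.
move=> vE; have {}vE : v = \sum_(i < size e) c i *: e`_i.
  by rewrite {1}vE; apply: eq_bigr => i _; rewrite /c valK.
rewrite -se {1}vE; apply: eq_bigr => i _; congr (_ *: _).
by rewrite vE inner_comb.
Qed.

End OrthonormalBases.

(** * Orthogonal projections and singular values *)

Section Projections.
Context {R : realType} {k : scalar_kind} {n : nat}.
Implicit Types (u v w : vec R k n) (U V W : Gr R k n) (e f : seq (vec R k n)).

Lemma proj_mem W u : orthoproj W u \in W.
Proof. exact: memv_pi. Qed.

(** Positivity of the inner product makes [W] and its orthogonal complement
    independent; the expansion on an orthonormal basis of [W], in the next lemma,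
    shows that they span. *)
Lemma capv_orthov W : (W :&: orthov (@inner R k n) W = 0)%VS.
Proof.
apply/eqP; rewrite -subv0; apply/subvP => u; rewrite memv_cap => /andP[uW /mem_orthovP h].
by rewrite memv0; apply/eqP/inner_eq0/h.
Qed.

Lemma inner_proj_orth W u w : w \in W -> inner (u - orthoproj W u) w = 0.
Proof.
move=> wW; have [e oe] := onb_exists W.
pose u0 := \sum_(i < \dim W) inner u e`_i *: e`_i.
have u0W : u0 \in W.
  apply: memv_suml => i _; apply: memvZ; apply: (onb_mem oe).
  by rewrite mem_nth// (onb_size oe).
have uu0 : u - u0 \in orthov (@inner R k n) W.
  apply/mem_orthovP => v /(onb_expand oe) -> /=.
  rewrite innerC inner_suml big1 ?rmorph0// => i _; rewrite innerZl [X in _ * X]innerC innerBl.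
  rewrite (inner_comb (fun i => inner u e`_i)) ?(onb_size oe)// ?subrr ?rmorph0 ?mulr0//.
  by case/andP: oe.
have := @daddv_pi_add _ _ W (orthov (@inner R k n) W) u (capv_orthov W).
rewrite -{1}[u](subrKC u0) memv_add// => /(_ isT) {1}<-.
rewrite -/(orthoproj W) addrAC subrr add0r.
by have /mem_orthovP := memv_pi (orthov (@inner R k n) W) W u; exact.
Qed.

Lemma proj_id W u : u \in W -> orthoproj W u = u.
Proof. by move=> uW; apply: daddv_pi_id => //; exact: capv_orthov. Qed.

Lemma inner_projl W u v : inner (orthoproj W u) v = inner (orthoproj W u) (orthoproj W v).
Proof.
apply/eqP; rewrite -subr_eq0 -innerBr innerC inner_proj_orth ?proj_mem//.
by rewrite rmorph0.
Qed.

Lemma proj_selfadjoint W : selfadjoint (orthoproj W).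
Proof.
by move=> u v; rewrite inner_projl [RHS]innerC [in RHS]inner_projl -innerC.
Qed.

Lemma sqnorm_proj W u :
  sqnorm u = sqnorm (orthoproj W u) + sqnorm (u - orthoproj W u).
Proof.
rewrite -{1}(subrK (orthoproj W u) u) [LHS]sqnormD /rinner inner_proj_orth ?proj_mem//.
by rewrite re0; ring.
Qed.

Lemma vnorm_proj_le W u : vnorm (orthoproj W u) <= vnorm u.
Proof.
by apply: le_vnorm; rewrite [leRHS](sqnorm_proj W) lerDl sqnorm_ge0.
Qed.

Lemma vnorm_proj_min W u w : w \in W -> vnorm (u - orthoproj W u) <= vnorm (u - w).
Proof.
move=> wW; apply: le_vnorm.
have -> : u - w = (u - orthoproj W u) + (orthoproj W u - w) by rewrite addrA subrK.
rewrite [leRHS]sqnormD /rinner inner_proj_orth ?re0 ?memvB ?proj_mem//.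
by rewrite mulr0 addr0 lerDl sqnorm_ge0.
Qed.

(** Almost inclusion: the gap of [V] in [W] is at most [g]. It is zero exactly when
    [V] is contained in [W], whatever the dimensions. *)
Definition near_sub (g : R) V W :=
  forall v, v \in V -> vnorm (v - orthoproj W v) <= g * vnorm v.

Lemma near_sub_le g h V W : g <= h -> near_sub g V W -> near_sub h V W.
Proof. by move=> gh VW v /VW/le_trans; apply; rewrite ler_wpM2r ?vnorm_ge0. Qed.

Lemma near_sub_trans g h U V W : 0 <= h ->
  near_sub g U V -> near_sub h V W -> near_sub (g + h) U W.
Proof.
move=> h0 UV VW u uU; set v := orthoproj V u.
apply: (le_trans (vnorm_proj_min u (proj_mem W v))).
have -> : u - orthoproj W v = (u - v) + (v - orthoproj W v) by rewrite addrA subrK.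
apply: (le_trans (vnorm_triangle (u - v) (v - orthoproj W v))); rewrite mulrDl; apply: lerD; first exact: UV.
by apply: le_trans (VW _ (proj_mem V u)) _; rewrite ler_wpM2l// vnorm_proj_le.
Qed.

(** The projection to [W] is injective on [V], for a vector of its kernel is at
    distance [|v|] from [W]. *)
Lemma near_sub_inj g V W : g < 1 -> near_sub g V W -> (\dim V <= \dim W)%N.
Proof.
move=> g1 VW; rewrite -(limg_dim_eq (f := orthoproj W) (U := V)); last first.
  apply/eqP; rewrite -subv0; apply/subvP => v; rewrite memv_cap memv_ker memv0.
  move=> /andP[/VW h /eqP Pv0]; have {}Pv0 : orthoproj W v = 0 by [].
  apply/eqP/vnorm_eq0; move: h; rewrite Pv0 subr0 => h.
  by have := vnorm_ge0 v; nra.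
by apply: dimvS; apply/subvP => _ /memv_imgP[v _ ->]; exact: proj_mem.
Qed.

Lemma re_mulC_ge0 (c : scalars R k) : 0 <= re (c * conjF c).
Proof. exact/re_ge0/mul_conjF_ge0. Qed.

(** In the singular bases, [|v|^2 - |P_W v|^2] is the sum of the
    [(1 - s_i^2) |c_i|^2], where the [c_i] are the coordinates of [v]. *)
Lemma proj_diagonal_near V W e f (s : nat -> R) (x : R) :
  onb V e -> onb W f -> (\dim V <= \dim W)%N -> 0 <= x ->
  (forall i, (i < \dim V)%N -> orthoproj W e`_i = of_real k (s i) *: f`_i /\ x <= s i) ->
  near_sub (Num.sqrt (1 - x ^+ 2)) V W.
Proof.
move=> oe of_ dVW x0 es v vV; 
have vE := onb_expand oe vV; set c := fun i : nat => inner v e`_i.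
have oe' : orthonormal (@inner R k n) e by case/andP: oe.
have of' : orthonormal (@inner R k n) f by case/andP: of_.
have Pv : orthoproj W v = \sum_(i < \dim V) (of_real k (s i) * c i) *: f`_i.
  rewrite {1}vE linear_sum; apply: eq_bigr => i _.
  by rewrite linearZ/= (es i _).1// scalerA mulrC.
have sv : sqnorm v = \sum_(i < \dim V) re (c i * conjF (c i)).
  by rewrite {1}vE (sqnorm_comb c)// (onb_size oe).
have sPv : sqnorm (orthoproj W v) = \sum_(i < \dim V) s i ^+ 2 * re (c i * conjF (c i)).
  rewrite Pv (sqnorm_comb (fun i => of_real k (s i) * c i)) ?(onb_size of_)//.
  apply: eq_bigr => i _; rewrite rmorphM conj_of_real.
  rewrite [X in re X](_ : _ = of_real k (s i) * (of_real k (s i) * (c i * conjF (c i)))).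
    by rewrite !re_of_realM mulrA.
  by rewrite -!mulrA; congr (_ * _); rewrite mulrCA.
rewrite /vnorm mulrC -sqrtrM ?sqnorm_ge0//; apply: ler_wsqrtr.
suff : x ^+ 2 * sqnorm v <= sqnorm (orthoproj W v).
  by have := sqnorm_proj W v; lra.
rewrite sPv sv mulr_sumr; apply: ler_sum => i _; apply: ler_wpM2r; first exact: re_mulC_ge0.
have [_ xs] := es i (ltn_ord i); rewrite ler_sqr ?nnegrE//; exact: le_trans xs.
Qed.

(** Let [e] be an orthonormal eigenbasis of [P_V P_W P_V] on [V]. Then
    [<P_W e_i, P_W e_j> = <P_V P_W e_i, e_j>] vanishes for [i != j], so the nonzero
    [P_W e_i], normalized, are orthonormal in [W]; they are extended to a basis. *)
Lemma svd_exists V W : (\dim V <= \dim W)%N ->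
  exists s, is_singular_values V W (orthoproj W) s.
Proof.
move=> dVW; set Q := orthoproj W.
pose S := (orthoproj V \o (Q \o orthoproj V))%VF.
have SE w : S w = orthoproj V (Q (orthoproj V w)) by rewrite /S !comp_lfunE.
have SA : selfadjoint S.
  by move=> u v; rewrite !SE !proj_selfadjoint.
have SV : (S @: V <= V)%VS.
  by apply/subvP => _ /memv_imgP[u _ ->]; rewrite SE proj_mem.
have [e0 oe0 e0S] := selfadjoint_onb SA SV.
have Qorth u v : u \in e0 -> v \in e0 -> u != v -> inner (Q u) (Q v) = 0.
  move=> ue ve uv; have uV := onb_mem oe0 ue; have vV := onb_mem oe0 ve.
  rewrite /Q -inner_projl -/Q -{1}(proj_id uV) -{1}(proj_id vV) -proj_selfadjoint.
  have [a aE] := e0S u ue.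
  rewrite -/Q -SE aE innerZl.
  case/andP: (oe0) => _ /orthonormal_memP[_ h].
  by rewrite h// (negbTE uv) mulr0.
(* The singular values are the norms of the projections: the eigenvectors with
   nonzero projection are sorted by it and come first. *)
pose r : rel (vec R k n) := fun u v => vnorm (Q v) <= vnorm (Q u).
have r_tot : total r by move=> u v; exact: le_total.
pose p : pred (vec R k n) := fun u => Q u != 0.
pose e1 := sort r [seq u <- e0 | p u]; pose e2 := [seq u <- e0 | predC p u].
have pe : perm_eq e0 (e1 ++ e2).
  rewrite perm_sym; apply: perm_trans (permEl (perm_filterC p e0)).
  by rewrite perm_cat2r (permEl (perm_sort _ _)).
have oe := onb_perm pe oe0; have se := onb_size oe.
have e1P u : u \in e1 -> Q u != 0 /\ u \in e0.
  by rewrite mem_sort mem_filter => /andP[].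
have e2P u : u \in e2 -> Q u = 0.
  by rewrite mem_filter => /andP[/negPn/eqP].
pose f1 := [seq of_real k (vnorm (Q u))^-1 *: Q u | u <- e1].
have of1 : orthonormal (@inner R k n) f1.
  apply: orthonormalPn => i j; rewrite size_map => ie je.
  rewrite !(nth_map 0)//; have [->|ij] := eqVneq i j.
    by apply: unit_vector; have [] := e1P _ (mem_nth 0 je).
  have [_ ue] := e1P _ (mem_nth 0 ie); have [_ ve] := e1P _ (mem_nth 0 je).
  rewrite innerZl innerZr Qorth ?mulr0// nth_uniq//.
  by case/andP: oe => _ /orthonormal_memP[+ _]; rewrite cat_uniq => /andP[].
have [g og] : exists g, onb W (f1 ++ g).
  by apply: onb_extend => // _ /mapP[u _ ->]; apply/memvZ/proj_mem.
exists [seq vnorm (Q u) | u <- e1 ++ e2]; split.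
- by rewrite size_map se; apply/esym/minn_idPl.
- have tr : transitive (>=%R : rel R) by exact: ge_trans.
  rewrite (sorted_pairwise tr) map_cat pairwise_cat; apply/and3P; split.
  + apply/allrelP => _ _ /mapP[u _ ->] /mapP[v /e2P ve ->].
    by rewrite /= ve vnorm0 vnorm_ge0.
  + by rewrite -(sorted_pairwise tr) sorted_map; exact: sort_sorted.
  + apply/(pairwiseP 0) => i j; rewrite !inE !size_map => ie je _.
    by rewrite !(nth_map 0)//= (e2P _ (mem_nth 0 ie)) (e2P _ (mem_nth 0 je)).
- by apply/allP => _ /mapP[u _ ->]; exact: vnorm_ge0.
- exists (e1 ++ e2), (f1 ++ g); split => // i iV.
  rewrite (nth_map 0) ?se// !nth_cat size_map; case: ltnP => ie.
    rewrite (nth_map 0)// scalerA -rmorphM mulfV ?rmorph1 ?scale1r//.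
    by have [+ _] := e1P _ (mem_nth 0 ie); apply: contra_neq; exact: vnorm_eq0.
  rewrite -/Q (e2P (nth _ _ _)); last first.
    by apply: mem_nth; rewrite ltn_subLR// -size_cat se.
  by rewrite vnorm0 rmorph0 scale0r.
Qed.

(** The smallest singular value [x] gives the gap [sqrt (1 - x^2)], attained at the last
    vector of the singular basis of [V]. In equal dimensions the decomposition can
    be read backwards, [P_V f_i = s_i e_i], whence the symmetry of the gap. *)
Lemma singular_values_near V W (s := singular_values V W (orthoproj W))
    (x := last 0 s) : (0 < \dim V)%N -> (\dim V <= \dim W)%N ->
  [/\ size s = \dim V, {in s, forall y, x <= y}, {in s, forall y, 0 <= y <= 1},
      forall g, near_sub g V W -> Num.sqrt (1 - x ^+ 2) <= g &
      near_sub (Num.sqrt (1 - x ^+ 2)) V W /\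
      (\dim V = \dim W -> near_sub (Num.sqrt (1 - x ^+ 2)) W V)].
Proof.
move=> V0 dVW; have : is_singular_values V W (orthoproj W) s.
  exact: (xgetPex [::] (svd_exists dVW)).
case; rewrite (minn_idPl dVW) => sz srt /allP pos [e [f [oe of_ es]]].
have {}oe : onb V e by []; have {}of_ : onb W f by [].
have s0 : s != [::] by rewrite -size_eq0 sz -lt0n.
have ls : x \in s by exact: last_mem.
have xnth : x = s`_(\dim V).-1 by rewrite /x -nth_last sz.
have lV : ((\dim V).-1 < \dim V)%N by rewrite prednK.
have xle : {in s, forall y, x <= y}.
  move=> y ys; have [i + <-] := nthP 0 ys; rewrite sz => iV; rewrite xnth.
  apply: (@sorted_leq_nth _ (>=%R : rel R) ge_trans lexx 0 s srt); rewrite ?inE ?sz//.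
  by rewrite -ltnS prednK.
have norm1 (B : Gr R k n) b i : onb B b -> (i < \dim B)%N -> vnorm b`_i = 1.
  move=> ob iB; have bb : inner b`_i b`_i = of_real k 1.
    by rewrite (onb_nth ob)// eqxx rmorph1.
  by rewrite /vnorm /sqnorm /rinner bb re_of_real sqrtr1.
have nsf a (u : vec R k n) : 0 <= a -> vnorm (of_real k a *: u) = a * vnorm u.
  by move=> a0; rewrite /vnorm sqnormZ sqrtrM ?sqr_ge0// sqrtr_sqr ger0_norm.
have sb : {in s, forall y, 0 <= y <= 1}.
  move=> y ys; rewrite pos//=; have [i + <-] := nthP 0 ys; rewrite sz => iV.
  have s_ge0 : 0 <= s`_i by apply: pos; rewrite mem_nth ?sz.
  have := vnorm_proj_le W e`_i; rewrite es// nsf// (norm1 V e)// (norm1 W f) ?mulr1//.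
  exact: leq_trans dVW.
have x0 : 0 <= x by have /andP[] := sb _ ls.
have xs i : (i < \dim V)%N -> x <= s`_i by move=> iV; apply: xle; rewrite mem_nth ?sz.
split => //.
- move=> g gVW; have := gVW _ (onb_mem oe (mem_nth 0 _)) => /(_ (\dim V).-1).
  rewrite (onb_size oe) => /(_ lV); rewrite (norm1 V e)// mulr1; apply: le_trans.
  apply: ler_wsqrtr; have := sqnorm_proj W e`_(\dim V).-1.
  rewrite -!sqr_vnorm (norm1 V e)// es// nsf -?xnth// (norm1 W f) ?(leq_trans lV)//.
  by lra.
- split.
    by apply: (@proj_diagonal_near V W e f (nth 0 s)) => // i iV; split; [exact: es|exact: xs].
  move=> dE; apply: (@proj_diagonal_near W V f e (nth 0 s)); rewrite -?dE// => i iV.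
  split; last exact: xs.
  rewrite (onb_expand oe (proj_mem V f`_i)) (bigD1 (Ordinal iV))//=.
  have cE j : (j < \dim V)%N -> inner (orthoproj V f`_i) e`_j = of_real k s`_j * (i == j)%:R.
    move=> jV; rewrite proj_selfadjoint proj_id ?(onb_mem oe) ?mem_nth ?(onb_size oe)//.
    rewrite -{1}(proj_id (onb_mem of_ (mem_nth 0 _ : f`_i \in f))) ?(onb_size of_) -?dE//.
    rewrite proj_selfadjoint es// innerZr conj_of_real (onb_nth of_) -?dE//.
  rewrite cE// eqxx mulr1 big1 ?addr0// => j ji; rewrite cE//.
  by rewrite eq_sym (negbTE (ji : (j : nat) != i)) mulr0 scale0r.
Qed.

End Projections.

(** * The asymmetric metrics and the gap *)

Section AsymmetricDistance.
Context {R : realType} {k : scalar_kind} {n : nat} (d : asym_metric).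
Implicit Types (U V W : Gr R k n).

Lemma near_sub0 g V W : \dim V = 0%N -> near_sub g V W.
Proof.
move=> /eqP; rewrite dimv_eq0 => /eqP -> v; rewrite memv0 => /eqP ->.
by rewrite linear0 subr0 vnorm0 mulr0.
Qed.

Lemma dimv_le V : (\dim V <= n)%N.
Proof. by rewrite (leq_trans (dimvS (subvf V)))// dimvf/= /dim/= mul1n. Qed.

Lemma principal_anglesP V W (th := principal_angles V W) :
  (0 < \dim V)%N -> (\dim V <= \dim W)%N ->
  [/\ size th = \dim V, all acute th, {in th, forall x, x <= last 0 th},
      forall g, near_sub g V W -> sin (last 0 th) <= g &
      near_sub (sin (last 0 th)) V W /\
      (\dim V = \dim W -> near_sub (sin (last 0 th)) W V)].
Proof.
move=> V0 dVW; rewrite /th /principal_angles => {th}.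
have [sz xle sb] := singular_values_near V0 dVW.
set s := singular_values _ _ _ in sz xle sb *.
have s0 : s != [::] by rewrite -size_eq0 sz -lt0n.
have -> : last 0 [seq acos x | x <- s] = acos (last 0 s).
  by case: s s0 {sz xle sb} => // y s _ /=; rewrite last_map.
have xb := sb _ (last_mem s0); have /andP[x0 x1] := xb.
have sE : sin (acos (last 0 s)) = Num.sqrt (1 - (last 0 s) ^+ 2).
  by rewrite sin_acos// x1 (le_trans _ x0)// lerN10.
rewrite sE => h1 h2; split => //.
- by rewrite size_map.
- by apply/allP => _ /mapP[y /sb ys ->]; exact: acute_acos.
- move=> _ /mapP[y ys ->]; apply: ler_acos; last exact: xle.
    by rewrite (le_trans _ x0)// lerN10.
  by have /andP[] := sb _ ys.
Qed.

Lemma asym_distE V W : (0 < \dim V)%N -> (\dim V <= \dim W)%N ->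
  asym_dist d V W = angle_dist d (principal_angles V W).
Proof. by rewrite /asym_dist lt0n leqNgt => /negbTE -> /negbTE ->. Qed.

Lemma principal_angles_neq0 V W : (0 < \dim V)%N -> (\dim V <= \dim W)%N ->
  principal_angles V W != [::].
Proof.
by move=> V0 dVW; have [sz _ _ _ _] := principal_anglesP V0 dVW; rewrite -size_eq0 sz -lt0n.
Qed.

Lemma asym_dist_contract V W : (\dim W < \dim V)%N ->
  asym_dist d V W = Delta d (\dim V).
Proof. by rewrite /asym_dist => h; rewrite h; case: eqP h => // ->. Qed.

Lemma sin_last_le_asym_dist V W : (0 < \dim V)%N -> (\dim V <= \dim W)%N ->
  sin (last 0 (principal_angles V W)) <= asym_dist d V W.
Proof.
move=> V0 dVW; rewrite asym_distE//; apply: sin_last_le_angle_dist.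
  by have [] := principal_anglesP V0 dVW.
exact: principal_angles_neq0.
Qed.

Lemma asym_dist_ge0 V W : 0 <= asym_dist d V W.
Proof.
have [V0|V0] := posnP (\dim V); first by rewrite /asym_dist V0.
have [WV|VW] := ltnP (\dim W) (\dim V).
  by rewrite asym_dist_contract// (le_trans ler01)// Delta_ge1.
apply: le_trans (sin_last_le_asym_dist V0 VW).
have [_ /allP ath _ _ _] := principal_anglesP V0 VW.
by have /acute_sin/andP[] := ath _ (last_mem (principal_angles_neq0 V0 VW)).
Qed.

Lemma asym_dist_le_Delta V W p : (0 < p)%N -> (\dim V <= p)%N -> asym_dist d V W <= Delta d p.
Proof.
move=> p0 Vp; have [V0|V0] := posnP (\dim V).
  by rewrite /asym_dist V0 eqxx (le_trans ler01)// Delta_ge1.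
apply: le_trans (Delta_le d Vp).
have [WV|VW] := ltnP (\dim W) (\dim V); first by rewrite asym_dist_contract.
rewrite asym_distE//; have [<- ath _ _ _] := principal_anglesP V0 VW.
exact/angle_dist_le_Delta/principal_angles_neq0.
Qed.

Lemma asym_dist_lt1 V W : asym_dist d V W < 1 -> (\dim V <= \dim W)%N.
Proof.
apply: contraTT; rewrite -ltnNge -leNgt => WV; rewrite asym_dist_contract//.
by apply: Delta_ge1; exact: leq_ltn_trans WV.
Qed.

Lemma near_sub_asym_dist V W : (\dim V <= \dim W)%N ->
  near_sub (asym_dist d V W) V W.
Proof.
move=> VW; have [V0|V0] := posnP (\dim V); first exact: near_sub0.
apply: near_sub_le (sin_last_le_asym_dist V0 VW) _.
by have [_ _ _ _ []] := principal_anglesP V0 VW.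
Qed.

Lemma near_sub_sym g V W : \dim V = \dim W -> near_sub g V W -> near_sub g W V.
Proof.
move=> dE VW; have [V0|V0] := posnP (\dim V); first by apply: near_sub0; rewrite -dE.
have [|_ _ _ h1 [_ h2]] := principal_anglesP V0 (W := W); first by rewrite dE.
exact: near_sub_le (h1 _ VW) (h2 dE).
Qed.

(** A bound [eta] on the gap, the sine of the largest angle, bounds that angle by
    monotonicity of the sine, and the distance is at most [n] times that angle. *)
Lemma asym_dist_small (eps : R) : 0 < eps -> exists2 eta, 0 < eta &
  forall V W, (\dim V <= \dim W)%N -> near_sub eta V W -> asym_dist d V W < eps.
Proof.
move=> e0; pose e1 := Num.min (eps / n.+1%:R) 1.
have e1e : e1 <= eps / n.+1%:R by rewrite ge_min lexx.
have e11 : e1 <= 1 by rewrite ge_min lexx orbT.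
have e10 : 0 < e1 by rewrite lt_min ltr01 andbT divr_gt0.
have pi1 := @pihalf_ge1 R.
have s0 : 0 < sin e1 by apply: sin_gt0_pi; have := @pihalf_le_pi R; rewrite e10/=; have := @pihalf_lt2 R; lra.
exists (sin e1 / 2); first by rewrite divr_gt0.
move=> V W VW nVW; have [V0|V0] := posnP (\dim V); first by rewrite /asym_dist V0 eqxx.
have [sz ath lth h1 _] := principal_anglesP V0 VW.
have th0 := principal_angles_neq0 V0 VW.
rewrite asym_distE//; set th := principal_angles V W in sz ath lth h1 th0 *.
apply: le_lt_trans (angle_dist_le_sum _ ath th0) _.
have /andP[l0 lpi] : acute (last 0 th) by exact/(allP ath)/last_mem.
have {h1} := h1 _ nVW => h1.
have l1 : last 0 th < e1.
  rewrite -ltr_sin ?in_itv/=; [lra| |]; apply/andP; split; lra.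
have := @sum_le_size R id _ _ lth; rewrite sz => h.
apply: le_lt_trans h _; apply: (@le_lt_trans _ _ (n%:R * e1)).
  by rewrite ler_pM ?ler_nat ?dimv_le ?(ltW l1)//.
have : e1 * n.+1%:R <= eps by rewrite -ler_pdivlMr.
by rewrite -natr1; lra.
Qed.

Lemma asym_dist_refl V : asym_dist d V V = 0.
Proof.
apply/eqP; rewrite eq_le asym_dist_ge0 andbT; apply/ler_addgt0Pl => e e0.
have [eta eta0 h] := asym_dist_small e0; rewrite addr0; apply/ltW/h => // v vV.
by rewrite proj_id// subrr vnorm0 mulr_ge0 ?vnorm_ge0// ltW.
Qed.

End AsymmetricDistance.

(** * Limits of subspaces *)

Section ScalarModulus.
Context {R : realType} {k : scalar_kind}.
Implicit Types (c : scalars R k).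

Definition modulus c : R := Num.sqrt (re (c * conjF c)).

Lemma modulus_ge0 c : 0 <= modulus c. Proof. exact: sqrtr_ge0. Qed.

Lemma sqr_modulus c : of_real k (modulus c ^+ 2) = c * conjF c.
Proof. by rewrite sqr_sqrtr -?ge0_of_real ?mul_conjF_ge0// re_ge0 ?mul_conjF_ge0. Qed.

Lemma normr_modulus c : `|c| = of_real k (modulus c).
Proof.
rewrite /modulus; case: k c => /= c; first by rewrite -expr2 sqrtr_sqr.
rewrite normc_def; case: c => a b /=.
by rewrite mulrN opprK -!expr2.
Qed.

Lemma of_real_lt (a b : R) : (of_real k a < of_real k b) = (a < b).
Proof. by case: k => //=; exact: ltcR. Qed.

End ScalarModulus.

Lemma cauchy_real_limit (R : realType) (T : Type) (F : set_system T) {FF : ProperFilter F}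
    (f : T -> R) :
  (forall e, 0 < e -> exists2 X, F X & forall s t, X s -> X t -> `|f s - f t| <= e) ->
  exists l, forall e, 0 < e -> \forall t \near F, `|f t - l| <= e.
Proof.
move=> fC; have : cvg (f @ F).
  apply/cauchy_cvgP/cauchy_exP => e e0.
  have [X FX Xe] := fC (e / 2) (divr_gt0 e0 (ltr0n _ 2)).
  have [s Xs] := filter_ex FX; exists (f s); rewrite /=; apply: filterS FX => t Xt.
  by rewrite -ball_normE/=; have := Xe _ _ Xs Xt; lra.
move=> /cvg_ex[l /= fl]; exists l => e e0.
by have /cvgrPdist_le/(_ _ e0) := fl; apply: filterS => t; rewrite distrC.
Qed.

Section Limits.
Context {R : realType} {k : scalar_kind} {n : nat} {T : Type}.
Context {F : set_system T} {FF : ProperFilter F}.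
Implicit Types (u v w : vec R k n) (U V W L : Gr R k n).

Lemma cauchy_scalar_limit (f : T -> scalars R k) :
  (forall e, 0 < e -> exists2 X, F X &
     forall s t, X s -> X t -> modulus (f s - f t) <= e) ->
  exists l, forall e, 0 < e -> \forall t \near F, modulus (f t - l) <= e.
Proof.
rewrite /modulus; case: k f => /= f fC.
  have [|l fl] := @cauchy_real_limit _ _ _ FF f.
    move=> e /fC[X FX Xe]; exists X => // s t Xs Xt.
    by have := Xe _ _ Xs Xt; rewrite -expr2 sqrtr_sqr.
  by exists l => e /fl; apply: filterS => t; rewrite -expr2 sqrtr_sqr.
have mE (a b : R) : Num.sqrt (complex.Re ((a +i* b)%C * conjc (a +i* b)%C)) =
    Num.sqrt (a ^+ 2 + b ^+ 2) by rewrite /= mulrN opprK -!expr2.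
have [|a fa] := @cauchy_real_limit _ _ _ FF (fun t => complex.Re (f t)).
  move=> e /fC[X FX Xe]; exists X => // s t Xs Xt; apply: le_trans (Xe _ _ Xs Xt).
  case: (f s) (f t) => [a b] [a' b']; rewrite [leRHS]mE -sqrtr_sqr ler_wsqrtr//=.
  by rewrite lerDl sqr_ge0.
have [|b fb] := @cauchy_real_limit _ _ _ FF (fun t => complex.Im (f t)).
  move=> e /fC[X FX Xe]; exists X => // s t Xs Xt; apply: le_trans (Xe _ _ Xs Xt).
  case: (f s) (f t) => [? ?] [? ?]; rewrite [leRHS]mE -sqrtr_sqr ler_wsqrtr//=.
  by rewrite lerDr sqr_ge0.
exists (a +i* b)%C => e e0; have e20 : 0 < e / 2 by rewrite divr_gt0.
apply: filterS2 (fa _ e20) (fb _ e20) => t.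
case: (f t) => a' b' /= ha hb; rewrite mulrN opprK -!expr2.
rewrite -[leRHS](ger0_norm (ltW e0)) -sqrtr_sqr ler_wsqrtr//.
rewrite -(real_normK (num_real (a' - a))) -(real_normK (num_real (b' - b))).
by have := normr_ge0 (a' - a); have := normr_ge0 (b' - b); nra.
Qed.

Lemma vnormZ (c : scalars R k) u : vnorm (c *: u) = modulus c * vnorm u.
Proof.
rewrite /vnorm /sqnorm /rinner innerZl innerZr mulrA -sqr_modulus re_of_realM.
by rewrite sqrtrM ?sqr_ge0// sqrtr_sqr ger0_norm ?modulus_ge0.
Qed.

Lemma vnorm_sum I (r : seq I) (f : I -> vec R k n) :
  vnorm (\sum_(i <- r) f i) <= \sum_(i <- r) vnorm (f i).
Proof.
elim: r => [|i r IH]; first by rewrite !big_nil vnorm0.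
by rewrite !big_cons; apply: le_trans (vnorm_triangle _ _) _; rewrite lerD2l.
Qed.

Lemma modulus_coord u j : modulus (u 0 j) <= vnorm u.
Proof.
apply: ler_wsqrtr; rewrite /sqnorm /rinner /inner (big_morph _ reD re0).
by rewrite (bigD1 j)//= lerDl sumr_ge0// => i _; exact: re_mulC_ge0.
Qed.

Lemma inner_delta u j : inner u (delta_mx 0 j) = u 0 j.
Proof.
rewrite /inner (bigD1 j)//= mxE !eqxx rmorph1 mulr1 big1 ?addr0// => i ij.
by rewrite mxE (negbTE ij) andbF rmorph0 mulr0.
Qed.

Lemma vnorm_delta j : vnorm (delta_mx 0 j : vec R k n) = 1.
Proof.
rewrite /vnorm /sqnorm /rinner inner_delta mxE !eqxx.
by rewrite -[X in re X](rmorph1 (of_real k)) re_of_real sqrtr1.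
Qed.

Lemma vnorm_le_coord u (e : R) : (forall j, modulus (u 0 j) <= e) -> vnorm u <= n%:R * e.
Proof.
move=> ue; rewrite [u]row_sum_delta; apply: le_trans (vnorm_sum _ _) _.
apply: le_trans (_ : \sum_(j < n) e <= _); last by rewrite sumr_const card_ord mulr_natl.
by apply: ler_sum => j _; rewrite vnormZ vnorm_delta mulr1.
Qed.

Lemma cauchy_vec_limit (f : T -> vec R k n) :
  (forall e, 0 < e -> exists2 X, F X & forall s t, X s -> X t -> vnorm (f s - f t) <= e) ->
  exists l, forall e, 0 < e -> \forall t \near F, vnorm (f t - l) <= e.
Proof.
move=> fC; have lim_coord j : exists l, forall e, 0 < e ->
    \forall t \near F, modulus (f t 0 j - l) <= e.
  apply: cauchy_scalar_limit => e /fC[X FX Xe]; exists X => // s t Xs Xt.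
  have := Xe _ _ Xs Xt; apply: le_trans.
  by have := modulus_coord (f s - f t) j; rewrite !mxE.
have [l lP] := choice lim_coord; exists (\row_j l j) => e e0; pose e' := e / n.+1%:R.
have e'0 : 0 < e' by rewrite divr_gt0.
have : \forall t \near F, forall j, modulus (f t 0 j - l j) <= e'.
  by apply: filter_forall => j; exact: lP.
apply: filterS => t h; apply: (@le_trans _ _ (n%:R * e')).
  by apply: vnorm_le_coord => j; rewrite !mxE.
have : e' * n.+1%:R <= e by rewrite -ler_pdivlMr.
by rewrite -natr1; nra.
Qed.

(** Closeness in both directions controls the difference of the projections,
    since [P - Q = P (1 - Q) - (1 - P) Q] and [P (1 - Q)] is the adjoint of [(1 - Q) P]. *)
Lemma vnorm_proj_diff g V W u : 0 <= g -> near_sub g V W -> near_sub g W V ->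
  vnorm (orthoproj V u - orthoproj W u) <= g *+ 2 * vnorm u.
Proof.
move=> g0 VW WV; set x := orthoproj V u - orthoproj W u.
have rproj (U : Gr R k n) v w : rinner (orthoproj U v) w = rinner v (orthoproj U w).
  by rewrite /rinner proj_selfadjoint.
have split_diff y : rinner (orthoproj V u - orthoproj W u) y =
    rinner u (orthoproj V y - orthoproj W (orthoproj V y))
    + rinner (- (orthoproj W u - orthoproj V (orthoproj W u))) y.
  by rewrite opprB !rinnerBl rinnerBr !rproj; ring.
have xE := split_diff x; rewrite -/x -/(sqnorm x) in xE.
have h1 := cauchy_schwarz u (orthoproj V x - orthoproj W (orthoproj V x)).
have h2 := cauchy_schwarz (- (orthoproj W u - orthoproj V (orthoproj W u))) x.
rewrite vnormN in h2.
have b1 := VW _ (proj_mem V x); have b2 := WV _ (proj_mem W u).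
have c1 := vnorm_proj_le V x; have c2 := vnorm_proj_le W u.
have u0 := vnorm_ge0 u; have x0 := vnorm_ge0 x.
have [->|xn0] := eqVneq (vnorm x) 0; first by rewrite mulr_ge0 ?mulrn_wge0.
have xp : 0 < vnorm x by rewrite lt_neqAle eq_sym xn0.
rewrite -(ler_pM2r xp) -expr2 sqr_vnorm xE mulr2n.
have d1 : vnorm u * vnorm (orthoproj V x - orthoproj W (orthoproj V x)) <= vnorm u * (g * vnorm x).
  by rewrite ler_wpM2l// (le_trans b1)// ler_wpM2l.
have d2 : vnorm (orthoproj W u - orthoproj V (orthoproj W u)) * vnorm x <= g * vnorm u * vnorm x.
  by rewrite ler_wpM2r// (le_trans b2)// ler_wpM2l.
by lra.
Qed.

Lemma near_sub_of_proj g V W :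
  (forall u, vnorm (orthoproj V u - orthoproj W u) <= g * vnorm u) -> near_sub g V W.
Proof. by move=> h v vV; have := h v; rewrite (proj_id vV). Qed.

Lemma proj_uniq W u w : w \in W -> (forall v, v \in W -> inner (u - w) v = 0) ->
  orthoproj W u = w.
Proof.
move=> wW uw; apply/eqP; rewrite -subr_eq0; apply/eqP/inner_eq0.
set x := _ - w; have xW : x \in W by rewrite memvB ?proj_mem.
have -> : inner x x = inner (u - w) x - inner (u - orthoproj W u) x.
  by rewrite -innerBl; congr inner; rewrite opprB addrC addrA subrK.
by rewrite uw// inner_proj_orth// subr0.
Qed.

(** Take [c = <u, v>], for which the left-hand side is [|<u, v>|^2]. *)
Lemma inner0_of_rinner u v : (forall c : scalars R k, rinner u (c *: v) <= 0) ->
  inner u v = 0.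
Proof.
move=> h; have := h (inner u v); rewrite /rinner innerZr mulrC -sqr_modulus re_of_real => m0.
apply/eqP; rewrite -normr_eq0 normr_modulus fmorph_eq0 -sqrf_eq0.
by rewrite eq_le m0 sqr_ge0.
Qed.

(** The projections converge pointwise, with matrix limit [M]. That [u - u M] is
    orthogonal to the image of [M] passes to the limit, so [M] is the matrix
    of the orthogonal projection to its image [L]. The dimension of [L] is that of
    nearby subspaces because the gaps both ways are less than [1]. *)
Lemma subspace_limit (A : T -> Gr R k n) q :
  (\forall t \near F, \dim (A t) = q) ->
  (forall e, 0 < e -> exists2 X, F X &
    forall s t, X s -> X t -> near_sub e (A s) (A t)) ->
  exists2 L, \dim L = q & forall e, 0 < e -> \forall t \near F,
    forall u, vnorm (orthoproj (A t) u - orthoproj L u) <= e * vnorm u.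
Proof.
move=> Aq AC.
have lim_row (i : 'I_n) : exists l, forall e, 0 < e -> \forall t \near F,
    vnorm (orthoproj (A t) (delta_mx 0 i) - l) <= e.
  apply: cauchy_vec_limit => e e0; have [X FX Xe] := AC _ (divr_gt0 e0 (ltr0n _ 2)).
  exists X => // s t Xs Xt; have e20 : 0 <= e / 2 by rewrite divr_ge0// ltW.
  have := vnorm_proj_diff (delta_mx 0 i) e20 (Xe _ _ Xs Xt) (Xe _ _ Xt Xs).
  by rewrite vnorm_delta mulr1 mulr2n -splitr.
have [l lP] := choice lim_row; pose M := \matrix_i l i.
have MP e : 0 < e -> \forall t \near F,
    forall u, vnorm (orthoproj (A t) u - u *m M) <= e * vnorm u.
  move=> e0; pose e' := e / n.+1%:R.
  have e'0 : 0 < e' by rewrite divr_gt0.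
  have : \forall t \near F, forall i, vnorm (orthoproj (A t) (delta_mx 0 i) - l i) <= e'.
    by apply: filter_forall => i; exact: lP.
  apply: filterS => t h u; rewrite [u in orthoproj _ u]row_sum_delta linear_sum.
  rewrite mulmx_sum_row -sumrB.
  apply: le_trans (vnorm_sum _ _) _.
  apply: (@le_trans _ _ (\sum_(i < n) vnorm u * e')).
    apply: ler_sum => i _; rewrite linearZ/= rowK -scalerBr vnormZ.
    by apply: ler_pM; rewrite ?modulus_ge0 ?vnorm_ge0 ?modulus_coord.
  rewrite sumr_const card_ord -mulr_natl.
  have e'e : e' * n.+1%:R <= e by rewrite -ler_pdivlMr.
  have u0 := vnorm_ge0 u; rewrite -natr1 in e'e.
  have : n%:R * e' <= e by lra.
  by move/(ler_wpM2r u0); lra.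
pose Q := linfun (mulmxr M : vec R k n -> vec R k n); pose L := limg Q.
have QE u : Q u = u *m M by rewrite lfunE.
have PL u : orthoproj L u = u *m M.
  rewrite -QE; apply: proj_uniq; first by rewrite memv_img ?memvf.
  move=> _ /memv_imgP[w _ ->]; apply: inner0_of_rinner => c.
  rewrite -linearZ /=; set v := c *: w; rewrite !QE.
  apply/ler_addgt0Pl => e e0; rewrite addr0.
  pose C := vnorm u * vnorm (v *m M) + vnorm u * vnorm v.
  have C0 : 0 <= C by rewrite addr_ge0 ?mulr_ge0 ?vnorm_ge0.
  have e'0 : 0 < e / (C + 1) by rewrite divr_gt0// ltr_wpDl.
  have [t h] := filter_ex (MP _ e'0); set e' := e / (C + 1) in e'0 h.
  (* [<u - P u, P v> = 0] for the projection [P] to [A t], close to [M]. *)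
  have -> : rinner (u - u *m M) (v *m M) =
      rinner (orthoproj (A t) u - u *m M) (v *m M) +
      rinner (u - orthoproj (A t) u) (- (orthoproj (A t) v - v *m M)).
    have o : rinner (u - orthoproj (A t) u) (orthoproj (A t) v) = 0.
      by rewrite /rinner inner_proj_orth ?proj_mem ?re0.
    by rewrite opprB rinnerBr o subr0 -rinnerDl; congr (rinner _ _); rewrite [RHS]addrC addrA subrK.
  have h1 := cauchy_schwarz (orthoproj (A t) u - u *m M) (v *m M).
  have h2 := cauchy_schwarz (u - orthoproj (A t) u) (- (orthoproj (A t) v - v *m M)).
  rewrite vnormN in h2; have hu := h u; have hv := h v.
  have n0 := vnorm_ge0 (v *m M); have u0 := vnorm_ge0 u; have v0 := vnorm_ge0 v.
  have u1 : vnorm (u - orthoproj (A t) u) <= vnorm u.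
    by apply: le_vnorm; rewrite [leRHS](sqnorm_proj (A t)) lerDr sqnorm_ge0.
  have k1 : vnorm (orthoproj (A t) u - u *m M) * vnorm (v *m M) <= e' * vnorm u * vnorm (v *m M).
    by rewrite ler_wpM2r.
  have k2 : vnorm (u - orthoproj (A t) u) * vnorm (orthoproj (A t) v - v *m M) <= vnorm u * (e' * vnorm v).
    by rewrite ler_pM ?vnorm_ge0.
  have ee : e' * (C + 1) = e by rewrite /e' divfK// gt_eqF// ltr_wpDl.
  by rewrite /C in ee; lra.
have conv e : 0 < e -> \forall t \near F,
    forall u, vnorm (orthoproj (A t) u - orthoproj L u) <= e * vnorm u.
  by move=> /MP; apply: filterS => t h u; rewrite PL.
exists L => //.
have half1 : 0 < 1 / 2 :> R by rewrite divr_gt0.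
have half2 : 1 / 2 < 1 :> R by lra.
have [t [<- h]] := filter_ex (filterI Aq (conv _ half1)).
have AL := near_sub_of_proj h.
have LA : near_sub (1 / 2) L (A t).
  by apply: near_sub_of_proj => u; rewrite -vnormN opprB.
by apply/eqP; rewrite eqn_leq (near_sub_inj half2 AL) (near_sub_inj half2 LA).
Qed.

End Limits.

Section GrassmannianLimits.
Context {R : realType} {k : scalar_kind} {n : nat}.
Context {F : set_system R} {FF : ProperFilter F}.
Implicit Types (V W L : Gr R k n).

Lemma proj_limit_Gr_limit (A : R -> Gr R k n) L :
  (\forall t \near F, \dim (A t) = \dim L) ->
  (forall e, 0 < e -> \forall t \near F,
    forall u, vnorm (orthoproj (A t) u - orthoproj L u) <= e * vnorm u) ->
  Gr_limit A F L.
Proof.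
move=> Ad AL; split => //; apply/cvg_ballP => eps eps0.
have epsE := ge0_of_real (ltW eps0).
have re0 : 0 < re eps by rewrite epsE -(rmorph0 (of_real k)) of_real_lt in eps0.
have e20 : 0 < re eps / 2 by rewrite divr_gt0.
apply: filterS (AL _ e20) => t h; split => // i j.
rewrite -ball_normE /= /projmx !mxE epsE normr_modulus of_real_lt.
apply: (@le_lt_trans _ _ (re eps / 2)); last by lra.
apply: le_trans (_ : vnorm (orthoproj L (delta_mx 0 i) - orthoproj (A t) (delta_mx 0 i)) <= _).
  have := modulus_coord (orthoproj L (delta_mx 0 i) - orthoproj (A t) (delta_mx 0 i)) j.
  by rewrite !mxE.
by rewrite -vnormN opprB; apply: le_trans (h _) _; rewrite vnorm_delta mulr1.
Qed.

Lemma near_sub_sub V W : (forall e, 0 < e -> near_sub e V W) -> (V <= W)%VS.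
Proof.
move=> VW; apply/subvP => v vV.
suff : v - orthoproj W v = 0 by move/subr0_eq => ->; exact: proj_mem.
apply: vnorm_eq0; apply/eqP; rewrite eq_le vnorm_ge0 andbT.
apply/ler_addgt0Pl => e e0; rewrite addr0.
have v1 : 0 < vnorm v + 1 by rewrite ltr_wpDl ?vnorm_ge0.
apply: le_trans (VW _ (divr_gt0 e0 v1) _ vV) _.
by rewrite mulrAC ler_pdivrMr// ler_wpM2l ?lerDl// ltW.
Qed.
End GrassmannianLimits.

(** * Partition sums and jumps of the length *)

Section PartitionSums.
Context {R : realType} (D : R -> R -> R) (D_ge0 : forall s t, 0 <= D s t).
Implicit Types (s t x y : R) (u v : seq R).

Definition chain_sum u : R := \sum_(i < (size u).-1) D u`_i u`_i.+1.

Lemma chain_sum_nil : chain_sum [::] = 0.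
Proof. exact: big_ord0. Qed.

Lemma chain_sum1 x : chain_sum [:: x] = 0.
Proof. exact: big_ord0. Qed.

Lemma chain_sum_cons x y u : chain_sum [:: x, y & u] = D x y + chain_sum (y :: u).
Proof. by rewrite /chain_sum /= big_ord_recl. Qed.

Lemma chain_sum_cat u x y v :
  chain_sum (rcons u x ++ y :: v) = chain_sum (rcons u x) + D x y + chain_sum (y :: v).
Proof.
elim: u => [|z [|w u] IH] /=.
- by rewrite chain_sum_cons chain_sum1 add0r.
- by rewrite !chain_sum_cons chain_sum1 addr0 addrA.
- by rewrite !chain_sum_cons -!addrA; congr (_ + _); rewrite addrA; exact: IH.
Qed.

Lemma chain_sum_cat_ge u v : chain_sum u + chain_sum v <= chain_sum (u ++ v).
Proof.
case/lastP: u => [|u x]; first by rewrite chain_sum_nil add0r.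
case: v => [|y v]; first by rewrite chain_sum_nil cats0 addr0.
by rewrite chain_sum_cat lerD2r lerDl.
Qed.

Lemma chain_sum_cat_le (B : R) u v : 0 <= B ->
  (forall x y, x \in u -> ohead v = Some y -> D x y <= B) ->
  chain_sum (u ++ v) <= chain_sum u + B + chain_sum v.
Proof.
case/lastP: u => [|u x] B0 DB; first by rewrite chain_sum_nil add0r lerDr.
case: v DB => [|y v] DB; first by rewrite chain_sum_nil cats0 addr0 lerDl.
by rewrite chain_sum_cat lerD2r lerD2l DB ?mem_rcons ?mem_head.
Qed.

Lemma sorted_cat_lt u v : sorted <%R u -> sorted <%R v ->
  (forall x y, x \in u -> y \in v -> x < y) -> sorted <%R (u ++ v).
Proof.
rewrite !(sorted_pairwise lt_trans) pairwise_cat => -> -> uv; rewrite !andbT.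
exact/allrelP.
Qed.

Lemma sorted_split t u : sorted <%R u -> u = [seq x <- u | x < t] ++
  [seq x <- u | x == t] ++ [seq x <- u | t < x].
Proof.
move=> su; have sf p : sorted <%R [seq x <- u | p x] by exact: sorted_filter lt_trans _ _ su.
apply: lt_sorted_eq => //.
  apply: sorted_cat_lt => //; first apply: sorted_cat_lt => //.
  - by move=> x y; rewrite !mem_filter => /andP[/eqP -> _] /andP[].
  - move=> x y; rewrite mem_cat !mem_filter => /andP[xt _] /orP[/andP[/eqP -> //]|].
    by move=> /andP[/(lt_trans xt)].
by move=> x; rewrite !mem_cat !mem_filter; case: (ltgtP x t); rewrite ?orbF.
Qed.

(** For [D s t = d (gamma s) (gamma t)] this is the length of the curve. *)
Definition chain_sup (A : set R) : \bar R :=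
  ereal_sup [set (chain_sum t)%:E | t in [set t : seq R | sorted <%R t /\ [set` t] `<=` A]].

Lemma chain_sup_ge A u : sorted <%R u -> [set` u] `<=` A ->
  ((chain_sum u)%:E <= chain_sup A)%E.
Proof. by move=> su uA; apply: ereal_sup_ubound; exists u. Qed.

Lemma chain_sup_le A (M : R) : (forall u, sorted <%R u -> [set` u] `<=` A ->
  chain_sum u <= M) -> (chain_sup A <= M%:E)%E.
Proof. by move=> h; apply: ub_ereal_sup => _ [u [su uA] <-]; rewrite lee_fin h. Qed.

Lemma chain_sup_ge0 A : (0 <= chain_sup A)%E.
Proof. by have := @chain_sup_ge A [::] isT; rewrite chain_sum_nil; apply. Qed.

Lemma chain_sup_adherent (A : set R) (eps : R) : (chain_sup A < +oo)%E -> 0 < eps ->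
  exists u, [/\ sorted <%R u, [set` u] `<=` A &
    forall v, sorted <%R v -> [set` v] `<=` A -> chain_sum v <= chain_sum u + eps].
Proof.
move=> Afin e0; have Afn : chain_sup A \is a fin_num.
  by rewrite ge0_fin_numE// chain_sup_ge0.
have [_ [u [su uA] <-] h] := ub_ereal_sup_adherent e0 Afn.
exists u; split => // v sv vA; have := chain_sup_ge sv vA.
move: h; rewrite -/(chain_sup A) -(fineK Afn) -EFinB lte_fin lee_fin; lra.
Qed.

Lemma chain_sup_sub A B : A `<=` B -> (chain_sup A <= chain_sup B)%E.
Proof.
by move=> AB; apply: le_ereal_sup => _ [u [su uA] <-]; exists u => //; split => // x /uA/AB.
Qed.

(** A partition nearly exhausting the length of the part of [A] beyond [t0] starts at a
    point strictly beyond [t0]; what lies before it contributes almost nothing. *)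
Lemma chain_sup_right (A : set R) t0 (eps : R) : (chain_sup A < +oo)%E -> 0 < eps ->
  exists2 delta, 0 < delta & forall u, sorted <%R u ->
    (forall x, x \in u -> A x /\ t0 < x < t0 + delta) -> chain_sum u <= eps.
Proof.
move=> Afin e0; pose B := A `&` [set x | t0 < x].
have [|u [su uB h]] := @chain_sup_adherent B eps _ e0.
  by apply: le_lt_trans Afin; apply: chain_sup_sub => x [].
case: u su uB h => [|x u] su uB h.
  exists 1 => // v sv vA; have := h v sv; rewrite chain_sum_nil add0r; apply.
  by move=> y /vA[Ay /andP[]].
have [_ tx] := uB x (mem_head _ _); rewrite /= in tx.
exists (x - t0); first by rewrite subr_gt0.
move=> v sv vA; have := h (v ++ x :: u); have := chain_sum_cat_ge v (x :: u).
suff [s1 s2] : sorted <%R (v ++ x :: u) /\ [set` v ++ x :: u] `<=` B.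
  by move=> h1 /(_ s1 s2); lra.
split; last first.
  move=> y /=; rewrite mem_cat => /orP[/vA[Ay /andP[]]//|]; exact: uB.
apply: sorted_cat_lt => // y z /vA[_ /andP[_ yx]] zu; rewrite subrKC in yx.
apply: lt_le_trans yx _; move: zu; rewrite inE => /predU1P[->//|zu].
by apply/ltW; move: su => /=; rewrite (path_sortedE lt_trans) => /andP[/allP/(_ _ zu)].
Qed.

Lemma chain_sup_left (A : set R) t0 (eps : R) : (chain_sup A < +oo)%E -> 0 < eps ->
  exists2 delta, 0 < delta & forall u, sorted <%R u ->
    (forall x, x \in u -> A x /\ t0 - delta < x < t0) -> chain_sum u <= eps.
Proof.
move=> Afin e0; pose B := A `&` [set x | x < t0].
have [|u [su uB h]] := @chain_sup_adherent B eps _ e0.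
  by apply: le_lt_trans Afin; apply: chain_sup_sub => x [].
case/lastP: u su uB h => [|u x] su uB h.
  exists 1 => // v sv vA; have := h v sv; rewrite chain_sum_nil add0r; apply.
  by move=> y /vA[Ay /andP[]].
have [_ tx] : B x by apply: uB; rewrite /= mem_rcons mem_head.
rewrite /= in tx; exists (t0 - x); first by rewrite subr_gt0.
move=> v sv vA; have := h (rcons u x ++ v); have := chain_sum_cat_ge (rcons u x) v.
suff [s1 s2] : sorted <%R (rcons u x ++ v) /\ [set` rcons u x ++ v] `<=` B.
  by move=> h1 /(_ s1 s2); lra.
split; last first.
  move=> y /=; rewrite mem_cat => /orP[|/vA[Ay /andP[]]//]; exact: uB.
apply: sorted_cat_lt => // z y zu /vA[_ /andP[xy _]]; rewrite subKr in xy.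
apply: le_lt_trans xy; move: zu; rewrite mem_rcons inE => /predU1P[->//|zu].
apply/ltW; move: su; rewrite -cats1 (sorted_pairwise lt_trans) pairwise_cat.
by case/andP => /allrelP/(_ z x zu); rewrite inE eqxx => ->.
Qed.

(** The length of a curve concentrates at a point as the jump [l1] into the point
    plus the jump [l2] out of it: the parts of a partition on either side
    contribute little by the two previous lemmas. The bound on [D s t] across [t0]
    is for the partitions that skip [t0]. *)
Lemma chain_sup_jump (A : set R) t0 (l1 l2 : R) :
  (chain_sup A < +oo)%E -> A t0 -> 0 <= l1 -> 0 <= l2 ->
  (forall eps : R, 0 < eps -> exists2 delta : R, 0 < delta & forall s t, A s -> A t ->
     t0 - delta < s < t0 -> t0 < t < t0 + delta -> D s t <= l1 + l2 + eps) ->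
  (forall eps : R, 0 < eps -> exists2 delta : R, 0 < delta & forall s, A s ->
     t0 - delta < s < t0 -> D s t0 <= l1 + eps) ->
  (forall eps : R, 0 < eps -> exists2 delta : R, 0 < delta & forall t, A t ->
     t0 < t < t0 + delta -> D t0 t <= l2 + eps) ->
  (forall delta : R, 0 < delta -> exists u, [/\ sorted <%R u,
     [set` u] `<=` A `&` `[t0 - delta, t0 + delta] & l1 + l2 <= chain_sum u]) ->
  chain_sup (A `&` `[t0 - delta, t0 + delta]) @[delta --> 0^'+] --> (l1 + l2)%:E.
Proof.
move=> Afin At0 l10 l20 H12 H1 H2 low.
pose W delta : set R := A `&` `[t0 - delta, t0 + delta].
have main (eps : R) : 0 < eps -> exists2 d0 : R, 0 < d0 & forall delta : R, 0 < delta -> delta < d0 ->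
    ((l1 + l2)%:E <= chain_sup (W delta) <= (l1 + l2 + eps)%:E)%E.
  move=> eps0; pose e := eps / 4; have e0 : 0 < e by rewrite divr_gt0.
  have [dl dl0 Hl] := chain_sup_left t0 Afin e0.
  have [dr dr0 Hr] := chain_sup_right t0 Afin e0.
  have [d1 d10 {}H1] := H1 _ e0; have [d2 d20 {}H2] := H2 _ e0.
  have [d3 d30 {}H12] := H12 _ e0.
  pose d0 := Num.min (Num.min dl dr) (Num.min (Num.min d1 d2) d3).
  exists d0; first by rewrite !lt_min dl0 dr0 d10 d20 d30.
  move=> delta delta0; rewrite !lt_min => /and3P[/andP[ddl ddr] /andP[dd1 dd2] dd3].
  apply/andP; split.
    have [u [su uA lu]] := low _ delta0.
    by apply: le_trans (chain_sup_ge su uA); rewrite lee_fin.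
  apply: chain_sup_le => u su uA.
  have uP x : x \in u -> A x /\ t0 - delta <= x <= t0 + delta.
    by move=> /uA[Ax]; rewrite /= in_itv.
  have sf p : sorted <%R [seq x <- u | p x] by exact: sorted_filter lt_trans _ _ su.
  have left x : x \in [seq x <- u | x < t0] -> A x /\ t0 - delta <= x < t0.
    by rewrite mem_filter => /andP[-> /uP[Ax /andP[-> _]]].
  have right x : x \in [seq x <- u | t0 < x] -> A x /\ t0 < x <= t0 + delta.
    by rewrite mem_filter => /andP[-> /uP[Ax /andP[_ ->]]].
  have Sl : chain_sum [seq x <- u | x < t0] <= e.
    by apply: Hl => // x /left[Ax xb]; split => //; lra.
  have Sr : chain_sum [seq x <- u | t0 < x] <= e.
    by apply: Hr => // x /right[Ax xb]; split => //; lra.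
  have mid : [seq x <- u | x == t0] = [::] \/ [seq x <- u | x == t0] = [:: t0].
    have := lt_sorted_uniq su; elim: (u) => [|x v IH] /=; first by left.
    case/andP=> xv /IH{}IH; case: eqVneq => [xt|_]; last exact: IH.
    right; rewrite xt; congr cons; apply/eqP; rewrite -[_ == _]negbK -has_filter.
    by apply/hasPn => y yv; rewrite -xt; apply: contraNneq xv => <-.
  have eE : eps = e * 4 by rewrite /e divfK.
  rewrite (sorted_split t0 su); case: mid => ->.
    have B0 : 0 <= l1 + l2 + e by lra.
    apply: le_trans (chain_sum_cat_le B0 _) _.
      move=> x y /left[Ax xb] hy; have {hy}/right[Ay yb] : y \in [seq x <- u | t0 < x].
        by move: hy; case: [seq x <- u | t0 < x] => //= z v [->]; exact: mem_head.
      by apply: H12 => //; lra.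
    by rewrite /=; lra.
  have B0 : 0 <= l1 + e by lra.
  apply: le_trans (chain_sum_cat_le B0 _) _.
    by move=> x y /left[Ax xb] [<-]; apply: H1 => //; lra.
  have := @chain_sum_cat_le (l2 + e) [:: t0] [seq x <- u | t0 < x].
  rewrite chain_sum1 add0r => H; have {H} := H (addr_ge0 l20 (ltW e0)).
  suff h : forall x y, x \in [:: t0] -> ohead [seq x <- u | t0 < x] = Some y -> D x y <= l2 + e.
    by move=> /(_ h); lra.
  move=> x y; rewrite inE => /eqP -> hy; have {hy}/right[Ay yb] : y \in [seq x <- u | t0 < x].
    by move: hy; case: [seq x <- u | t0 < x] => //= z v [->]; exact: mem_head.
  by apply: H2 => //; lra.
apply/fine_cvgP; split.
  have [d0 d00 h] := main _ ltr01; near=> delta.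
  have /andP[] : ((l1 + l2)%:E <= chain_sup (W delta) <= (l1 + l2 + 1)%:E)%E.
    by apply: h; near: delta; [exact: nbhs_right_gt|exact: nbhs_right_lt].
  by case: chain_sup.
apply/cvgrPdist_le => eps eps0; have [d0 d00 h] := main _ eps0; near=> delta.
have : ((l1 + l2)%:E <= chain_sup (W delta) <= (l1 + l2 + eps)%:E)%E.
  by apply: h; near: delta; [exact: nbhs_right_gt|exact: nbhs_right_lt].
rewrite /=; case: chain_sup => [r||] //=; rewrite ?lee_fin => /andP[h1 h2].
by rewrite ler_distlC; apply/andP; split; lra.
Unshelve. all: by end_near. Qed.

End PartitionSums.

(** * Curves near a point *)

Lemma least_value (T : Type) (f : T -> nat) (S : set T) : S !=set0 ->
  exists2 t, S t & forall s, S s -> (f t <= f s)%N.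
Proof.
move=> [t0 St0]; pose P m := `[< exists2 t, S t & f t = m >].
have exP : exists m, P m by exists (f t0); apply/asboolP; exists t0.
case: (ex_minnP exP) => m /asboolP[t St <-] h; exists t => // s Ss.
by apply: h; apply/asboolP; exists s.
Qed.

Section OneSidedLimits.
Context {R : realType} {k : scalar_kind} {n : nat} (d : asym_metric).
Implicit Types (U V W L : Gr R k n).

(** The hypothesis bounds [d (gamma s) (gamma t)] only for [s < t]; equality of the
    dimensions supplies the gap in the other order. *)
Lemma one_sided_limit (F : set_system R) {FF : ProperFilter F} (gamma : R -> Gr R k n) q :
  (\forall t \near F, \dim (gamma t) = q) ->
  (forall e, 0 < e -> exists2 X, F X & forall s t, X s -> X t -> s < t ->
     asym_dist d (gamma s) (gamma t) <= e) ->
  exists L, [/\ \dim L = q, Gr_limit gamma F L & forall e, 0 < e ->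
    \forall t \near F, near_sub e L (gamma t) /\ near_sub e (gamma t) L].
Proof.
move=> Fq FC; have [e e0|L Lq LP] := subspace_limit Fq.
  have [X FX XP] := FC _ e0.
  exists (X `&` [set t | \dim (gamma t) = q]); first exact: filterI.
  move=> s t [Xs /= sq] [Xt /= tq]; case: (ltgtP s t) => [st|ts|->].
  - by apply: near_sub_le (XP _ _ Xs Xt st) _; apply: near_sub_asym_dist; rewrite sq tq.
  - apply: near_sub_sym; first by rewrite sq tq.
    by apply: near_sub_le (XP _ _ Xt Xs ts) _; apply: near_sub_asym_dist; rewrite sq tq.
  - by move=> v vV; rewrite proj_id// subrr vnorm0 mulr_ge0 ?vnorm_ge0// ltW.
exists L; split => //.
  by apply: proj_limit_Gr_limit => //; apply: filterS Fq => t ->.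
move=> e /LP; apply: filterS => t h; split; apply: near_sub_of_proj => // u.
by rewrite -vnormN opprB.
Qed.

(** Replaces the triangle inequality of [d], which the gap satisfies more simply. *)
Lemma asym_dist_via (eps : R) : 0 < eps -> exists2 eta, 0 < eta & forall U V W,
  (\dim U <= \dim W)%N -> near_sub eta U V -> near_sub eta V W ->
  asym_dist d U W < eps.
Proof.
move=> /(asym_dist_small (k := k) (n := n) d)[eta eta0 h].
exists (eta / 2); first by rewrite divr_gt0.
move=> U V W UW UV VW; apply: h => //.
have -> : eta = eta / 2 + eta / 2 by rewrite -splitr.
by apply: near_sub_trans VW; rewrite // divr_ge0// ltW.
Qed.

Lemma asym_dist_swap_small (eps : R) : 0 < eps -> exists2 eta, 0 < eta & forall V W,
  \dim V = \dim W -> asym_dist d V W < eta -> asym_dist d W V < eps.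
Proof.
move=> /(asym_dist_small (k := k) (n := n) d)[eta eta0 h].
exists eta => // V W dVW VWe; apply: h; first by rewrite dVW.
apply: near_sub_sym => //; apply: near_sub_le (ltW VWe) _.
by apply: near_sub_asym_dist; rewrite dVW.
Qed.

Lemma strict_subspace_dim V W : (V <= W)%VS -> V != W -> (\dim V < \dim W)%N.
Proof.
move=> VW; rewrite ltn_neqAle dimvS// andbT; apply: contra_neq => dVW.
by apply/eqP; rewrite eqEdim VW dVW /=.
Qed.

End OneSidedLimits.

Section CurveAtPoint.
Context {R : realType} {k : scalar_kind} {n : nat} (d : asym_metric).
Context (gamma : R -> Gr R k n) (I : interval R) (t0 : R).
Context (rect : rectifiable_curve d gamma I) (t0I : t0 \in I).

Local Notation D s t := (asym_dist d (gamma s) (gamma t)).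

Definition right_of (delta : R) : set R := [set t | t \in I /\ t0 < t < t0 + delta].
Definition left_of (delta : R) : set R := [set t | t \in I /\ t0 - delta < t < t0].

Lemma at_right_right_of t1 delta : t1 \in I -> t0 < t1 -> 0 < delta ->
  t0^'+ (right_of delta).
Proof.
move=> t1I t01 delta0; near=> t; have t0t : t0 < t by near: t; exact: nbhs_right_gt.
have tt1 : t < t1 by near: t; exact: nbhs_right_lt.
split; first by apply: (interval_is_interval t0I t1I); rewrite !ltW.
by rewrite t0t; near: t; apply: nbhs_right_lt; rewrite ltrDl.
Unshelve. all: by end_near. Qed.

Lemma at_left_left_of t1 delta : t1 \in I -> t1 < t0 -> 0 < delta ->
  t0^'- (left_of delta).
Proof.
move=> t1I t10 delta0; near=> t; have tt0 : t < t0 by near: t; exact: nbhs_left_lt.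
have t1t : t1 < t by near: t; exact: nbhs_left_gt.
split; first by apply: (interval_is_interval t1I t0I); rewrite !ltW.
by rewrite tt0 andbT; near: t; apply: nbhs_left_gt; rewrite ltrBlDr ltrDl.
Unshelve. all: by end_near. Qed.

Lemma right_cauchy e : 0 < e -> exists2 delta, 0 < delta &
  forall s t, right_of delta s -> right_of delta t -> s < t -> D s t <= e.
Proof.
move=> e0; have [||delta delta0 h] := @chain_sup_right R (fun s t => D s t) _ [set` I] t0 e _ e0.
- by move=> s t; exact: asym_dist_ge0.
- exact: rect.
exists delta => // s t [sI sb] [tI tb] st; have := h [:: s; t].
rewrite chain_sum_cons chain_sum1 addr0; apply; first by rewrite /= st.
by move=> x; rewrite !inE => /orP[] /eqP ->.
Qed.

Lemma left_cauchy e : 0 < e -> exists2 delta, 0 < delta &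
  forall s t, left_of delta s -> left_of delta t -> s < t -> D s t <= e.
Proof.
move=> e0; have [||delta delta0 h] := @chain_sup_left R (fun s t => D s t) _ [set` I] t0 e _ e0.
- by move=> s t; exact: asym_dist_ge0.
- exact: rect.
exists delta => // s t [sI sb] [tI tb] st; have := h [:: s; t].
rewrite chain_sum_cons chain_sum1 addr0; apply; first by rewrite /= st.
by move=> x; rewrite !inE => /orP[] /eqP ->.
Qed.

(** By [right_cauchy] the dimension is nondecreasing on some interval
    [t0 < t < t0 + delta]; it is constant before a point where it is least. *)
Lemma right_dim_const t1 : t1 \in I -> t0 < t1 -> exists q, exists2 delta, 0 < delta &
  forall t, right_of delta t -> \dim (gamma t) = q.
Proof.
move=> t1I t01; have half0 : 0 < 1 / 2 :> R by rewrite divr_gt0.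
have [delta delta0 h] := right_cauchy half0.
have [t [tI tb] tmin] := least_value (fun t => \dim (gamma t))
  (filter_ex (at_right_right_of t1I t01 delta0)).
exists (\dim (gamma t)), (t - t0); first by rewrite subr_gt0; case/andP: tb.
move=> s [sI]; rewrite subrKC => /andP[ts st].
have sR : right_of delta s by split => //; lra.
apply/eqP; rewrite eqn_leq tmin// andbT; apply: (@asym_dist_lt1 _ _ _ d).
by apply: le_lt_trans (h _ _ sR _ st) _; [split|lra].
Qed.

(** Here the dimension is constant after a point where it is greatest; this is phrased
    with [n - dim] so as to use a least value again. *)
Lemma left_dim_const t1 : t1 \in I -> t1 < t0 -> exists q, exists2 delta, 0 < delta &
  forall t, left_of delta t -> \dim (gamma t) = q.
Proof.
move=> t1I t10; have half0 : 0 < 1 / 2 :> R by rewrite divr_gt0.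
have [delta delta0 h] := left_cauchy half0.
have [t [tI tb] tmax] := least_value (fun t => n - \dim (gamma t))%N
  (filter_ex (at_left_left_of t1I t10 delta0)).
exists (\dim (gamma t)), (t0 - t); first by rewrite subr_gt0; case/andP: tb.
move=> s [sI]; rewrite subKr => /andP[ts st].
have sL : left_of delta s by split => //; lra.
apply/eqP; rewrite eqn_leq; apply/andP; split.
  by have := tmax _ sL; rewrite leq_sub2lE ?dimv_le.
apply: (@asym_dist_lt1 _ _ _ d).
by apply: le_lt_trans (h _ _ _ sL ts) _; [split|lra].
Qed.

Lemma right_of_min a b t : right_of (Num.min a b) t -> right_of a t /\ right_of b t.
Proof.
by move=> [tI /andP[tt]]; rewrite -ltrBlDl lt_min => /andP[ta tb]; split; split=> //; lra.
Qed.

Lemma left_of_min a b t : left_of (Num.min a b) t -> left_of a t /\ left_of b t.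
Proof.
by move=> [tI]; rewrite ltrBlDr -ltrBlDl lt_min => /andP[/andP[ta tb] tt]; split; split=> //; lra.
Qed.

Lemma length_jump (l1 l2 : R) : 0 <= l1 -> 0 <= l2 ->
  (forall eps : R, 0 < eps -> exists2 delta : R, 0 < delta &
     forall s t, left_of delta s -> right_of delta t -> D s t <= l1 + l2 + eps) ->
  (forall eps : R, 0 < eps -> exists2 delta : R, 0 < delta &
     forall s, left_of delta s -> D s t0 <= l1 + eps) ->
  (forall eps : R, 0 < eps -> exists2 delta : R, 0 < delta &
     forall t, right_of delta t -> D t0 t <= l2 + eps) ->
  (l1 + l2 = 0 \/ (forall delta, 0 < delta -> exists2 t, left_of delta t & l1 + l2 <= D t t0) \/
     (forall delta, 0 < delta -> exists2 t, right_of delta t & l1 + l2 <= D t0 t)) ->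
  has_length_change d gamma I t0 (l1 + l2)%:E.
Proof.
move=> l10 l20 H12 H1 H2 low.
apply: (@chain_sup_jump R (fun s t => D s t)) => //.
- by move=> s t; exact: asym_dist_ge0.
- move=> eps /H12[delta delta0 h]; exists delta => // s t sI tI sb tb.
  by apply: h; split.
- by move=> eps /H1[delta delta0 h]; exists delta => // s sI sb; apply: h; split.
- by move=> eps /H2[delta delta0 h]; exists delta => // s sI sb; apply: h; split.
move=> delta delta0; have inW x : t0 - delta <= x <= t0 + delta -> [set` `[t0 - delta, t0 + delta]] x.
  by rewrite /= in_itv.
case: low => [->|[/(_ _ delta0)|/(_ _ delta0)]].
- by exists [::]; rewrite chain_sum_nil.
- case=> t [tI tb] lt; exists [:: t; t0]; rewrite chain_sum_cons chain_sum1 addr0.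
  split => //=; first by case/andP: tb => _ ->.
  by move=> x /=; rewrite !inE => /orP[]/eqP ->; (split; [by []|apply: inW; lra]).
- case=> t [tI tb] lt; exists [:: t0; t]; rewrite chain_sum_cons chain_sum1 addr0.
  split => //=; first by case/andP: tb => ->.
  by move=> x /=; rewrite !inE => /orP[]/eqP ->; (split; [by []|apply: inW; lra]).
Qed.

(** The dimension from which the curve contracts is unique, since a contraction can
    occur on one side of [t0] only. *)
Definition length_change_dichotomy : Prop :=
  (exists p, [/\ contracts_from_dim gamma I t0 p,
     forall q, contracts_from_dim gamma I t0 q -> q = p &
     has_length_change d gamma I t0 (Delta d p)%:E]) \/
  ((forall p, ~ contracts_from_dim gamma I t0 p) /\
     has_length_change d gamma I t0 0%:E).

Section TauMinus.
Context (cont : forall e, 0 < e -> exists2 delta, 0 < delta &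
  forall t, t \in I -> t0 - delta < t < t0 + delta -> D t t0 < e).

Lemma minus_left e : 0 < e -> exists2 delta, 0 < delta &
  forall t, left_of delta t -> D t t0 < e.
Proof.
by move=> /cont[delta delta0 h]; exists delta => // t [tI tb]; apply: h => //; lra.
Qed.

Lemma minus_right e : 0 < e -> exists2 delta, 0 < delta &
  forall t, right_of delta t -> D t t0 < e.
Proof.
by move=> /cont[delta delta0 h]; exists delta => // t [tI tb]; apply: h => //; lra.
Qed.

Lemma minus_no_left_contraction U : ~ contracts_from_left_limit gamma I t0 U.
Proof.
case=> -[t1 t1I t10] [Udim _] VU VnU; have := strict_subspace_dim VU VnU.
have [delta delta0 h] := minus_left ltr01.
have [t [tU tL]] := filter_ex (@filterI _ t0^'- _ _ _ Udim (at_left_left_of t1I t10 delta0)).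
by rewrite -tU ltnNge (asym_dist_lt1 (h _ tL)).
Qed.

Lemma minus_length_change : length_change_dichotomy.
Proof.
pose V := gamma t0.
have noleft p : contracts_from_dim gamma I t0 p -> \dim V = p /\
    exists W, contracts_to_right_limit gamma I t0 W.
  by case=> [[U /minus_no_left_contraction []]|[]].
have Hleft (eps : R) : 0 < eps -> exists2 delta : R, 0 < delta &
    forall s, left_of delta s -> D s t0 <= 0 + eps.
  move=> /minus_left[delta delta0 h]; exists delta => // s /h; rewrite add0r; exact: ltW.
have dimleft : exists2 delta, 0 < delta & forall s, left_of delta s -> (\dim (gamma s) <= \dim V)%N.
  by have [delta delta0 h] := minus_left ltr01; exists delta => // s /h/asym_dist_lt1.
case: (pselect (exists2 t1, t1 \in I & t0 < t1)) => [[t1 t1I t01]|noright]; last first.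
  right; split; first by move=> p /noleft[_ [W []]].
  have nor delta t : ~ right_of delta t.
    by move=> [tI /andP[tt _]]; apply: noright; exists t.
  rewrite -[0]addr0; apply: length_jump => //; last by left; rewrite addr0.
    by move=> eps eps0; exists 1 => // s t _ /nor.
  by move=> eps eps0; exists 1 => // t /nor.
have [q [delta1 delta10 Rq]] := right_dim_const t1I t01.
have ex_right delta : 0 < delta -> right_of delta !=set0.
  by move=> /(at_right_right_of t1I t01)/filter_ex.
have qV : (q <= \dim V)%N.
  have [delta delta0 h] := minus_right ltr01.
  have m0 : 0 < Num.min delta delta1 by rewrite lt_min delta0.
  have [t /right_of_min[td /Rq <-]] := ex_right _ m0.
  by apply: (@asym_dist_lt1 _ _ _ d); exact: h.
have Fq : \forall t \near t0^'+, \dim (gamma t) = q.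
  by apply: filterS (at_right_right_of t1I t01 delta10); exact: Rq.
move: qV; rewrite leq_eqVlt => /orP[/eqP qV|qV].
  right; split.
    move=> p /noleft[_ [W [_ [Wdim _] WV WnV]]]; have := strict_subspace_dim WV WnV.
    have [t [/= tq tW]] := filter_ex (@filterI _ t0^'+ _ _ _ Fq Wdim).
    by rewrite -tW tq qV ltnn.
  rewrite -[0]addr0; apply: length_jump => //; last by left; rewrite addr0.
    move=> eps eps0; have [eta eta0 via] := @asym_dist_via R k n d eps eps0.
    have [dl dl0 hl] := minus_left eta0; have [dr dr0 hr] := minus_right eta0.
    have [d2 d20 h2] := dimleft.
    exists (Num.min (Num.min dl d2) (Num.min dr delta1)).
      by rewrite !lt_min dl0 d20 dr0.
    move=> s t /left_of_min[/left_of_min[sl s2] _] /right_of_min[_ /right_of_min[tr t1R]].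
    rewrite !add0r; apply/ltW/(via _ V).
    - by rewrite (Rq _ t1R) qV h2.
    - by apply: near_sub_le (ltW (hl _ sl)) _; apply: near_sub_asym_dist; exact: h2.
    - apply: near_sub_sym; first by rewrite (Rq _ t1R).
      apply: near_sub_le (ltW (hr _ tr)) _.
      by apply: near_sub_asym_dist; rewrite (Rq _ t1R) qV.
  move=> eps eps0; have [eta eta0 swap] := @asym_dist_swap_small R k n d eps eps0.
  have [dr dr0 hr] := minus_right eta0.
  exists (Num.min dr delta1); first by rewrite lt_min dr0.
  move=> t /right_of_min[/hr tr /Rq tq]; rewrite add0r; apply/ltW/swap => //.
  by rewrite tq qV.
left; exists (\dim V).
have V0 : (0 < \dim V)%N by exact: leq_ltn_trans qV.
have Delta0 : 0 <= Delta d (\dim V) :> R by rewrite (le_trans ler01)// Delta_ge1.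
have DE t : right_of delta1 t -> D t0 t = Delta d (\dim V).
  by move=> /Rq tq; apply: asym_dist_contract; rewrite tq.
split; last 1 first.
- rewrite -[Delta d _]add0r; apply: length_jump => //.
  + move=> eps eps0; have [dl dl0 hl] := dimleft; exists dl => // s t sL _.
    by rewrite add0r (le_trans (asym_dist_le_Delta _ _ V0 (hl _ sL)))// lerDl ltW.
  + by move=> eps eps0; exists delta1 => // t /DE ->; rewrite lerDl ltW.
  + right; right=> delta delta0.
    have m0 : 0 < Num.min delta delta1 by rewrite lt_min delta0.
    by have [t /right_of_min[td /DE tE]] := ex_right _ m0; exists t => //; rewrite tE add0r.
- right; split => //.
  have [|L [Lq GL LP]] := @one_sided_limit R k n d _ _ gamma q Fq.
    move=> e /right_cauchy[delta delta0 h]; exists (right_of delta) => //.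
    exact: (at_right_right_of t1I t01 delta0).
  exists L; split => //; first by exists t1.
    apply: near_sub_sub => e e0; have e20 : 0 < e / 2 by rewrite divr_gt0.
    have [dr dr0 hr] := minus_right e20.
    have m0 : 0 < Num.min dr delta1 by rewrite lt_min dr0.
    have [t [/right_of_min[tr /Rq tq] [Lt _]]] := filter_ex
      (@filterI _ t0^'+ _ _ _ (at_right_right_of t1I t01 m0) (LP _ e20)).
    rewrite (splitr e); apply: near_sub_trans Lt _; first exact: ltW.
    apply: near_sub_le (ltW (hr _ tr)) _; apply: near_sub_asym_dist.
    by rewrite tq ltnW.
  by apply: contraTneq qV => LV; rewrite /V -LV Lq ltnn.
- by move=> p /noleft[].
Qed.

End TauMinus.

Section TauPlus.
Context (cont : forall e, 0 < e -> exists2 delta, 0 < delta &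
  forall t, t \in I -> t0 - delta < t < t0 + delta -> D t0 t < e).

Lemma plus_left e : 0 < e -> exists2 delta, 0 < delta &
  forall t, left_of delta t -> D t0 t < e.
Proof.
by move=> /cont[delta delta0 h]; exists delta => // t [tI tb]; apply: h => //; lra.
Qed.

Lemma plus_right e : 0 < e -> exists2 delta, 0 < delta &
  forall t, right_of delta t -> D t0 t < e.
Proof.
by move=> /cont[delta delta0 h]; exists delta => // t [tI tb]; apply: h => //; lra.
Qed.

Lemma plus_no_right_contraction W : ~ contracts_to_right_limit gamma I t0 W.
Proof.
case=> -[t1 t1I t01] [Wdim _] WV WnV; have := strict_subspace_dim WV WnV.
have [delta delta0 h] := plus_right ltr01.
have [t [tW tR]] := filter_ex (@filterI _ t0^'+ _ _ _ Wdim (at_right_right_of t1I t01 delta0)).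
by rewrite -tW ltnNge (asym_dist_lt1 (h _ tR)).
Qed.

Lemma plus_length_change : length_change_dichotomy.
Proof.
pose V := gamma t0.
have noright p : contracts_from_dim gamma I t0 p ->
    exists2 U, contracts_from_left_limit gamma I t0 U & \dim U = p.
  by case=> [//|[[W /plus_no_right_contraction []]]].
have Hright (eps : R) : 0 < eps -> exists2 delta : R, 0 < delta &
    forall t, right_of delta t -> D t0 t <= 0 + eps.
  move=> /plus_right[delta delta0 h]; exists delta => // t /h; rewrite add0r; exact: ltW.
have dimright : exists2 delta, 0 < delta & forall t, right_of delta t -> (\dim V <= \dim (gamma t))%N.
  by have [delta delta0 h] := plus_right ltr01; exists delta => // t /h/asym_dist_lt1.
case: (pselect (exists2 t1, t1 \in I & t1 < t0)) => [[t1 t1I t10]|noleft]; last first.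
  right; split; first by move=> p /noright[U []].
  have nol delta t : ~ left_of delta t.
    by move=> [tI /andP[_ tt]]; apply: noleft; exists t.
  rewrite -[0]addr0; apply: length_jump => //; last by left; rewrite addr0.
    by move=> eps eps0; exists 1 => // s t /nol.
  by move=> eps eps0; exists 1 => // t /nol.
have [q [delta1 delta10 Lq]] := left_dim_const t1I t10.
have ex_left delta : 0 < delta -> left_of delta !=set0.
  by move=> /(at_left_left_of t1I t10)/filter_ex.
have Vq : (\dim V <= q)%N.
  have [delta delta0 h] := plus_left ltr01.
  have m0 : 0 < Num.min delta delta1 by rewrite lt_min delta0.
  have [t /left_of_min[td /Lq <-]] := ex_left _ m0.
  by apply: (@asym_dist_lt1 _ _ _ d); exact: h.
have Fq : \forall t \near t0^'-, \dim (gamma t) = q.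
  by apply: filterS (at_left_left_of t1I t10 delta10); exact: Lq.
have contr_dim p : contracts_from_dim gamma I t0 p -> p = q /\ (\dim V < q)%N.
  move=> /noright[U [_ [Udim _] VU VnU] <-]; have := strict_subspace_dim VU VnU.
  by have [t [/= <- <-]] := filter_ex (@filterI _ t0^'- _ _ _ Fq Udim).
move: (Vq); rewrite leq_eqVlt => /orP[/eqP qV|qV].
  right; split; first by move=> p /contr_dim[_]; rewrite qV ltnn.
  rewrite -[0]addr0; apply: length_jump => //; last by left; rewrite addr0.
    move=> eps eps0; have [eta eta0 via] := @asym_dist_via R k n d eps eps0.
    have [dl dl0 hl] := plus_left eta0; have [dr dr0 hr] := plus_right eta0.
    have [d2 d20 h2] := dimright.
    exists (Num.min (Num.min dl delta1) (Num.min dr d2)).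
      by rewrite !lt_min dl0 d20 dr0 delta10.
    move=> s t /left_of_min[/left_of_min[sl /Lq sq] _] /right_of_min[_ /right_of_min[tr t2]].
    rewrite !add0r; apply/ltW/(via _ V).
    - by rewrite sq -qV h2.
    - apply: near_sub_sym; first by rewrite sq.
      apply: near_sub_le (ltW (hl _ sl)) _.
      by apply: near_sub_asym_dist; rewrite sq -qV.
    - by apply: near_sub_le (ltW (hr _ tr)) _; apply: near_sub_asym_dist; exact: h2.
  move=> eps eps0; have [eta eta0 swap] := @asym_dist_swap_small R k n d eps eps0.
  have [dl dl0 hl] := plus_left eta0.
  exists (Num.min dl delta1); first by rewrite lt_min dl0.
  move=> t /left_of_min[/hl tl /Lq tq]; rewrite add0r; apply/ltW/swap => //.
  by rewrite tq -qV.
left; exists q.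
have q0 : (0 < q)%N by exact: leq_ltn_trans qV.
have Delta0 : 0 <= Delta d q :> R by rewrite (le_trans ler01)// Delta_ge1.
have DE t : left_of delta1 t -> D t t0 = Delta d q.
  by move=> /Lq tq; rewrite asym_dist_contract tq.
split; last 1 first.
- rewrite -[Delta d _]addr0; apply: length_jump => //.
  + move=> eps eps0; exists delta1 => // s t /Lq sq _; rewrite addr0.
    by rewrite (le_trans (asym_dist_le_Delta _ _ q0 _)) ?sq// lerDl ltW.
  + by move=> eps eps0; exists delta1 => // t /DE ->; rewrite lerDl ltW.
  + right; left=> delta delta0.
    have m0 : 0 < Num.min delta delta1 by rewrite lt_min delta0.
    by have [t /left_of_min[td /DE tE]] := ex_left _ m0; exists t => //; rewrite tE addr0.
- left; have [|L [Ldim GL LP]] := @one_sided_limit R k n d _ _ gamma q Fq.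
    move=> e /left_cauchy[delta delta0 h]; exists (left_of delta) => //.
    exact: (at_left_left_of t1I t10 delta0).
  exists L => //; split => //; first by exists t1.
    apply: near_sub_sub => e e0; have e20 : 0 < e / 2 by rewrite divr_gt0.
    have [dl dl0 hl] := plus_left e20.
    have m0 : 0 < Num.min dl delta1 by rewrite lt_min dl0.
    have [t [/left_of_min[tl /Lq tq] [_ tL]]] := filter_ex
      (@filterI _ t0^'- _ _ _ (at_left_left_of t1I t10 m0) (LP _ e20)).
    rewrite (splitr e); apply: near_sub_trans tL; first exact: ltW.
    apply: near_sub_le (ltW (hl _ tl)) _; apply: near_sub_asym_dist.
    by rewrite tq.
  by apply: contraTneq qV => LV; rewrite /V LV Ldim ltnn.
- by move=> p /contr_dim[].
Qed.

End TauPlus.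

End CurveAtPoint.

(** The balls form a subbase, and [d V V = 0] makes the ball centred at [gamma t0] a
    neighbourhood of its centre. *)
Lemma asym_ball_continuity (R : realType) (k : scalar_kind) (n : nat)
    (d : asym_metric) (s : topology_side) (I : interval R)
    (gamma : R -> Gr_top R k n d s) (t0 : R) :
  {within [set` I], continuous gamma} -> t0 \in I ->
  forall e, 0 < e -> exists2 delta, 0 < delta & forall t, t \in I ->
    t0 - delta < t < t0 + delta -> asym_ball d s (gamma t0) e (gamma t).
Proof.
move=> /subspace_continuousP cont t0I e e0.
have [delta /= delta0 h] : within [set` I] (nbhs t0) (gamma @^-1` asym_ball d s (gamma t0) e).
  apply: (cont t0 t0I); apply: open_nbhs_nbhs; split; last first.
    by case: s gamma cont => gamma cont /=; rewrite asym_dist_refl.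
  exists [set asym_ball d s (gamma t0) e]; last exact: bigcup_set1.
  move=> _ ->; apply: (@finI_from1 _ _ _ id); by exists (gamma t0), e.
exists delta => // t tI tb; apply: h => //.
by rewrite /= ltr_distlC.
Qed.

Unset Implicit Arguments.

Theorem proposition4p13 (R : realType) (k : scalar_kind) (n : nat)
    (d : asym_metric) (s : topology_side) (I : interval R)
    (gamma : R -> Gr_top R k n d s) (t0 : R) :
  {within [set` I], continuous gamma} ->
  rectifiable_curve d gamma I ->
  t0 \in I ->
  (forall p : nat, contracts_from_dim gamma I t0 p ->
     has_length_change d gamma I t0 (Delta d p)%:E) /\
  ((forall p : nat, ~ contracts_from_dim gamma I t0 p) ->
     has_length_change d gamma I t0 0%:E).
Proof.
move=> cont rect t0I.
have ball_cont := asym_ball_continuity cont t0I.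
have [[p [pC puniq pL]]|[noC L0]] : length_change_dichotomy d gamma I t0.
- by case: s gamma cont rect ball_cont => gamma _ rect bc;
    [exact: minus_length_change|exact: plus_length_change].
- by split=> [q /puniq ->|/(_ _ pC)].
- by split=> // q /noC.
Qed.
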